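(* Let $\lambda=\sum_{i=1}^n m_i\omega_i$ be a dominant integral weight of $\mathfrak{sl}_{n+1}(\mathbb{C})$. For every weight $\mu$, $$p_{\lambda,\mu}(q)=\sum_{\mathbf{s}\in S(\lambda)^\mu}q^{\deg\mathbf{s}},$$ and $$\mathrm{char}_q(V(\lambda))=\sum_{\mathbf{s}\in S(\lambda)}e^{\lambda-\mathrm{wt}(\mathbf{s})}q^{\deg(\mathbf{s})}.$$
   Context: Let $\mathfrak{g}=\mathfrak{sl}_{n+1}(\mathbb{C})=\mathfrak{n}^+\oplus\mathfrak{h}\oplus\mathfrak{n}^-$ be a Cartan decomposition, with simple roots $\alpha_1,\dots,\alpha_n$, fundamental weights $\omega_1,\dots,\omega_n$ and weight lattice $P$. The positive roots are $\alpha_{p,q}=\alpha_p+\dots+\alpha_q$, $1\le p\le q\le n$ (so $\alpha_{i,i}=\alpha_i$). PBW filtration: $U(\mathfrak{n}^-)_s=\mathrm{span}\{x_1\cdots x_l : x_i\in\mathfrak{n}^-,\ l\le s\}$. Let $V(\lambda)$ be the irreducible $\mathfrak{g}$-module of highest weight $\lambda$ with highest weight vector $v_\lambda$, and $V(\lambda)_s=U(\mathfrak{n}^-)_s v_\lambda$ (with $V(\lambda)_{-1}=0$). For a weight $\mu$ let $V(\lambda)^\mu$ be the $\mu$-weight space and $V(\lambda)^\mu_s=V(\lambda)^\mu\cap V(\lambda)_s$. The graded character of the weight space is $$p_{\lambda,\mu}(q)=\sum_{s\ge0}\left(\dim V(\lambda)^\mu_s/V(\lambda)^\mu_{s-1}\right)q^s,$$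 and the graded character of $V(\lambda)$ is $\mathrm{char}_q(V(\lambda))=\sum_{\mu\in P}p_{\lambda,\mu}(q)e^\mu$. A multi-exponent is a tuple $\mathbf{s}=(s_\alpha)_{\alpha>0}$ of non-negative integers indexed by the positive roots; write $s_{j,k}=s_{\alpha_{j,k}}$. Its weight is $\mathrm{wt}(\mathbf{s})=\sum_{1\le j\le k\le n}s_{j,k}\alpha_{j,k}$ and its degree is $\deg(\mathbf{s})=\sum_{1\le j\le k\le n}s_{j,k}$. A Dyck path is a sequence $\mathbf{p}=(\beta(0),\dots,\beta(k))$, $k\ge0$, of positive roots such that either $k=0$ and $\mathbf{p}=(\alpha_i)$ for some simple root $\alpha_i$, or $k\ge1$, $\beta(0)=\alpha_i$, $\beta(k)=\alpha_j$ for some $1\le i<j\le n$, and whenever $\beta(s)=\alpha_{p,q}$ with $s<k$, then $\beta(s+1)=\alpha_{p,q+1}$ or $\beta(s+1)=\alpha_{p+1,q}$. For $\lambda=\sum m_i\omega_i$ dominant integral, $S(\lambda)$ is the set of all multi-exponents $\mathbf{s}$ such that for every Dyck path $\mathbf{p}=(\beta(0),\dots,\beta(k))$ with $\beta(0)=\alpha_i$, $\beta(k)=\alpha_j$ one has $s_{\beta(0)}+\dots+s_{\beta(k)}\le m_i+m_{i+1}+\dots+m_j$. $S(\lambda)^\mu$ is the subset of those $\mathbf{s}\in S(\lambda)$ with $\mu=\lambda-\mathrm{wt}(\mathbf{s})$. *)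

(* Defs.v *)
From HB Require Import structures.
From mathcomp Require Import all_boot all_order all_algebra.
From mathcomp Require Import ring.
From mathcomp Require Import finmap.
From mathcomp Require Import boolp classical_sets functions cardinality fsbigop.
From mathcomp Require Import reals.
From mathcomp Require Import complex.
From mathcomp Require Import monalg.

Set Implicit Arguments.
Unset Strict Implicit.
Unset Printing Implicit Defensive.

Import Order.TTheory GRing.Theory Num.Theory.
Local Open Scope classical_set_scope.
Local Open Scope ring_scope.

(** * Linear spans *)

(* The linear span of a set of vectors: the smallest subspace containing it.
   It exists by [vspan_exists], so the default value is never used. *)
Definition vspan (F : fieldType) (V : vectType F) (A : set V) : {vspace V} :=
  xget 0%VS [set U : {vspace V} | A `<=` [set` U] /\
    forall W : {vspace V}, A `<=` [set` W] -> (U <= W)%VS].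

Section VSpan.
Variables (F : fieldType) (V : vectType F).
Implicit Types (A : set V) (U W : {vspace V}).

Lemma vspan_exists A : exists U, A `<=` [set` U] /\
  forall W, A `<=` [set` W] -> (U <= W)%VS.
Proof.
suff H k : forall U, (\dim U <= k)%N -> A `<=` [set` U] -> exists U,
  A `<=` [set` U] /\ forall W, A `<=` [set` W] -> (U <= W)%VS.
  by apply: (H (\dim {:V}) fullv) => // x _ /=; rewrite memvf.
elim: k => [|k IH] U dU AU.
  exists U; split=> // W _.
  by move: dU; rewrite leqn0 dimv_eq0 => /eqP ->; rewrite sub0v.
have [minU|/existsNP[W /not_implyP[AW nUW]]] :=
  pselect (forall W, A `<=` [set` W] -> (U <= W)%VS); first by exists U.
apply: (IH (U :&: W)%VS); last first.
  by move=> x Ax /=; rewrite memv_cap (AU _ Ax) (AW _ Ax).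
rewrite -ltnS (leq_trans _ dU) // ltnNge; apply/negP => dUW; apply: nUW.
suff <- : (U :&: W)%VS = U by apply: capvSr.
by apply/eqP; rewrite eqEdim capvSl.
Qed.

Lemma vspanP A : A `<=` [set` vspan A] /\
  forall W, A `<=` [set` W] -> (vspan A <= W)%VS.
Proof.
rewrite /vspan; case: xgetP => [U -> //|noU].
by have [U HU] := vspan_exists A; case: (noU U).
Qed.

Lemma mem_vspan A x : A x -> x \in vspan A.
Proof. by have [H _] := vspanP A; exact: H. Qed.

Lemma vspan_min A W : (forall x, A x -> x \in W) -> (vspan A <= W)%VS.
Proof. by have [_ H] := vspanP A; exact: H. Qed.

(* A set which is already closed under linear combinations is its own span. *)
Lemma vspan_id A : A 0 -> (forall a x y, A x -> A y -> A (a *: x + y)) ->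
  forall x, x \in vspan A <-> A x.
Proof.
move=> A0 Alin x; split=> [xA|]; last exact: mem_vspan.
pose P k := `[< exists2 U : {vspace V}, \dim U = k & [set` U] `<=` A >].
have P0 : exists k, P k.
  exists 0%N; apply/asboolP; exists 0%VS; first by rewrite dimv0.
  by move=> y /=; rewrite memv0 => /eqP ->.
have Pb k : P k -> (k <= \dim {:V})%N.
  by move/asboolP => [U <- _]; rewrite dimvS ?subvf.
case: (ex_maxnP P0 Pb) => k /asboolP[U dU UA] kmax.
apply: (UA); move: xA; apply/subvP; apply: vspan_min => y Ay.
apply/negPn/negP => yU.
suff /kmax : P (\dim (<[y]> + U)%VS).
  rewrite -dU => dyU; case/negP: yU.
  have /eqP -> : U == (<[y]> + U)%VS by rewrite eqEdim addvSr.
  by apply: (subvP (addvSl _ _)); exact: memv_line.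
apply/asboolP; exists (<[y]> + U)%VS => // z /=.
by move=> /memv_addP[_ /vlineP[a ->] [u uU ->]]; apply: Alin => //; exact: UA.
Qed.

End VSpan.

(** * The Lie algebra sl_(n+1) and its standard Cartan decomposition

   Indices start at 0: i : 'I_n stands for the simple root alpha_(i+1), and
   matrices have rows and columns indexed by 'I_n.+1. *)

Section SL.
Variables (F : fieldType) (n : nat).

Definition trace_fun : 'M[F]_n.+1 -> F^o := mxtrace.

Fact trace_fun_is_linear : linear trace_fun.
Proof. by move=> a A B; rewrite /trace_fun mxtraceD mxtraceZ. Qed.
HB.instance Definition _ :=
  GRing.isLinear.Build F 'M[F]_n.+1 F^o *:%R trace_fun trace_fun_is_linear.

Definition sl : {vspace 'M[F]_n.+1} := lker (linfun trace_fun).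

Lemma mem_sl (A : 'M[F]_n.+1) : (A \in sl) = (\tr A == 0).
Proof. by rewrite memv_ker lfunE. Qed.

(* The type of elements of sl_(n+1), with [vsval] the inclusion in matrices. *)
Definition slT := subvs_of sl.

Definition lie_bracket (x y : slT) : slT :=
  vsproj sl (vsval x *m vsval y - vsval y *m vsval x).

Lemma lie_bracketE (x y : slT) :
  vsval (lie_bracket x y) = vsval x *m vsval y - vsval y *m vsval x.
Proof. by rewrite vsprojK // mem_sl raddfB /= mxtrace_mulC subrr. Qed.

Definition nplus (x : slT) : Prop :=
  forall i j : 'I_n.+1, (j <= i)%N -> vsval x i j = 0.

Definition cartan (x : slT) : Prop := is_diag_mx (vsval x).

Definition nminus (x : slT) : Prop :=
  forall i j : 'I_n.+1, (i <= j)%N -> vsval x i j = 0.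

End SL.

(** * Weights and roots *)

Section Weights.
Variable n : nat.

(* The weight lattice, in coordinates with respect to the fundamental weights:
   [mu] stands for the sum of the [mu 0 i] omega_(i+1). *)
Definition weight := 'rV[int]_n.

Definition dominant_weight (m : {ffun 'I_n -> nat}) : weight :=
  \row_i (m i)%:Z.

(* omega_(i+1) and weights as linear forms on the Cartan subalgebra; omega_(i+1)
   maps diag(h_0, .., h_n) to h_0 + .. + h_i. *)
Definition fund_weight (F : fieldType) (i : 'I_n) (h : slT F n) : F :=
  \sum_(k < n.+1 | (k <= i)%N) vsval h k k.

Definition weight_form (F : fieldType) (mu : weight) (h : slT F n) : F :=
  \sum_(i < n) (mu 0 i)%:~R * fund_weight i h.

(* The rows of the Cartan matrix of type A_n; see [simple_root_form]. *)
Definition simple_root (i : 'I_n) : weight :=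
  \row_j (if i == j then 2
          else if (i.+1 == j) || (j.+1 == i :> nat) then - 1 else 0).

Lemma simple_root_form (F : fieldType) (i : 'I_n) (h : slT F n) :
  weight_form (simple_root i) h =
  vsval h (widen_ord (leqnSn n) i) (widen_ord (leqnSn n) i)
  - vsval h (lift ord0 i) (lift ord0 i).
Proof.
pose d (k : nat) : F := if insub k is Some k' then vsval h k' k' else 0.
have dE (k : 'I_n.+1) : vsval h k k = d k by rewrite /d valK.
have fundE (j : 'I_n) : fund_weight j h = \sum_(0 <= k < j.+1) d k.
  rewrite /fund_weight (eq_bigr (fun k : 'I_n.+1 => d k)) => [|k _]; last exact: dE.
  by rewrite big_mkord (big_ord_widen n.+1 d) ?ltnS // ltnW.
pose S k := \sum_(0 <= l < k) d l.
have Sn : S n.+1 = 0.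
  have := subvsP h; rewrite mem_sl => /eqP trh; rewrite /S big_mkord -[RHS]trh.
  by apply: eq_bigr => k _; rewrite dE.
have S0 : S 0%N = 0 by rewrite /S big_nil.
have SS k : S k.+1 = S k + d k by rewrite /S big_nat_recr.
pose c (k : nat) : int :=
  if i == k :> nat then 2 else if (i.+1 == k) || (k.+1 == i) then - 1 else 0.
have -> : weight_form (simple_root i) h = \sum_(k < n.+1) (c k)%:~R * S k.+1.
  rewrite big_ord_recr /= Sn mulr0 addr0.
  by apply: eq_bigr => k _; rewrite fundE /simple_root mxE.
have cE (k : nat) : (c k)%:~R =
    (k == i)%:R + (k == i)%:R - (k == i.+1)%:R - (k.+1 == i)%:R :> F.
  rewrite /c (eq_sym i.+1) (eq_sym (i : nat)).
  have [ki|ki|->] := ltngtP k i.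
  - rewrite (ltn_eqF (ltnW ki : (k < i.+1)%N)) /= addr0 subr0 sub0r.
    by case: (k.+1 == i :> nat); rewrite /= ?mulrN1z ?oppr0.
  - rewrite (gtn_eqF (ltnW ki : (i < k.+1)%N)) orbF addr0 subr0 sub0r.
    by case: (k == i.+1); rewrite /= ?mulrN1z ?oppr0.
  - by rewrite ltn_eqF // gtn_eqF // !subr0.
have delta a : (a < n.+1)%N -> \sum_(k < n.+1) (k == a :> nat)%:R * S k.+1 = S a.+1.
  move=> an; rewrite (bigD1 (Ordinal an)) //= eqxx mul1r big1 ?addr0 // => k.
  by rewrite -val_eqE /= => /negPf ->; rewrite mul0r.
rewrite !dE /= /bump /= add1n.
under eq_bigr do rewrite cE 2!mulrBl mulrDl.
rewrite !sumrB big_split /= !delta ?ltnS ?(ltnW (ltn_ord i)) //.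
have -> : \sum_(k < n.+1) (k.+1 == i)%:R * S k.+1 = S i.
  case: (i) => -[|j] jn /=; first by rewrite S0 big1 // => k _; rewrite mul0r.
  by rewrite -(delta j) // ltnS ltnW // ltnW.
rewrite !SS; ring.
Qed.

(* (p, q) with p <= q stands for the positive root alpha_(p+1,q+1). *)
Definition posroot := {pq : 'I_n * 'I_n | (pq.1 <= pq.2)%N}.

Definition root_fst (b : posroot) : 'I_n := (val b).1.
Definition root_snd (b : posroot) : 'I_n := (val b).2.

Definition simple (i : 'I_n) : posroot := exist _ (i, i) (leqnn i).

Definition root_weight (b : posroot) : weight :=
  \sum_(i < n | (root_fst b <= i <= root_snd b)%N) simple_root i.

Definition multiexp := {ffun posroot -> nat}.

Definition wt (s : multiexp) : weight := \sum_b root_weight b *+ s b.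

Definition deg (s : multiexp) : nat := (\sum_b s b)%N.

(** * Dyck paths and the set S(lambda) *)

Definition dyck_step (b c : posroot) : bool :=
  ((root_fst c == root_fst b) && (root_snd c == (root_snd b).+1 :> nat))
  || ((root_fst c == (root_fst b).+1 :> nat) && (root_snd c == root_snd b)).

(* The sequence b :: p is a Dyck path starting at the simple root i and ending
   at the simple root j. *)
Definition dyck_path (i j : 'I_n) (b : posroot) (p : seq posroot) : bool :=
  [&& b == simple i, last b p == simple j, nilp p || (i < j)%N
    & path dyck_step b p].

Definition FFL (m : {ffun 'I_n -> nat}) : set multiexp :=
  [set s | forall (i j : 'I_n) (b : posroot) (p : seq posroot),
     dyck_path i j b p ->
     (\sum_(c <- b :: p) s c <= \sum_(k < n | (i <= k <= j)%N) m k)%N].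

Definition FFL_weight (m : {ffun 'I_n -> nat}) (mu : weight) : set multiexp :=
  [set s | FFL m s /\ mu = dominant_weight m - wt s].

End Weights.

(** * Representations of sl_(n+1) *)

Section Representations.
Variables (F : fieldType) (n : nat) (V : vectType F).
Implicit Types (rho : {linear slT F n -> 'End(V)}) (v : V) (mu : weight n).

Definition is_rep rho : Prop := forall x y : slT F n,
  rho (lie_bracket x y) = (rho x \o rho y)%VF - (rho y \o rho x)%VF.

Definition irreducible_rep rho : Prop := fullv != 0%VS :> {vspace V} /\
  forall U : {vspace V},
    (forall x, (rho x @: U <= U)%VS) -> U = 0%VS \/ U = fullv.

Definition highest_weight_vector rho mu v : Prop :=
  [/\ v != 0, forall x, nplus x -> rho x v = 0
    & forall h, cartan h -> rho h v = weight_form mu h *: v].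

(* [rho], with highest weight vector [v], is the irreducible module V(mu). *)
Definition irreducible_highest_weight rho mu v : Prop :=
  [/\ is_rep rho, irreducible_rep rho & highest_weight_vector rho mu v].

Definition weight_space rho mu : {vspace V} :=
  vspan [set u | forall h, cartan h -> rho h u = weight_form mu h *: u].

Lemma mem_weight_space rho mu u : u \in weight_space rho mu <->
  forall h, cartan h -> rho h u = weight_form mu h *: u.
Proof.
apply: vspan_id => [h _|a x y xP yP h hC]; first by rewrite linear0 scaler0.
by rewrite linearD linearZ /= (xP _ hC) (yP _ hC) scalerDr !scalerA mulrC.
Qed.

(* The product x_1 .. x_l of U(g) applied to a vector. *)
Definition word_act rho (xs : seq (slT F n)) v : V :=
  foldr (fun x u => rho x u) v xs.

(* V_s = U(n^-)_s v *)
Definition pbw_filtration rho v (s : nat) : {vspace V} :=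
  vspan [set u | exists xs : seq (slT F n),
    [/\ (size xs <= s)%N, forall x, x \in xs -> nminus x
      & u = word_act rho xs v]].

Definition pbw_weight rho v mu (s : nat) : {vspace V} :=
  (weight_space rho mu :&: pbw_filtration rho v s)%VS.

Definition pbw_weight_pred rho v mu (s : nat) : {vspace V} :=
  if s is s'.+1 then pbw_weight rho v mu s' else 0%VS.

(* dim V^mu_s / V^mu_(s-1); the quotient is realized by a complement. *)
Definition gr_dim rho v mu (s : nat) : nat :=
  \dim (pbw_weight rho v mu s :\: pbw_weight_pred rho v mu s)%VS.

Lemma finite_gr_dim rho v mu : finite_set [set s | gr_dim rho v mu s != 0%N].
Proof.
have mono s t : (s <= t)%N ->
    (pbw_weight rho v mu s <= pbw_weight rho v mu t)%VS.
  move=> st; apply: capvS => //; apply: vspan_min => u [xs [sxs xsN ->]].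
  by apply: mem_vspan; exists xs; split=> //; exact: leq_trans sxs st.
pose P k := `[< exists s, \dim (pbw_weight rho v mu s) = k >].
have P0 : exists k, P k.
  by exists (\dim (pbw_weight rho v mu 0)); apply/asboolP; exists 0%N.
have Pb k : P k -> (k <= \dim {:V})%N.
  by move/asboolP => [s <-]; rewrite dimvS ?subvf.
case: (ex_maxnP P0 Pb) => k /asboolP[N dN] kmax.
apply: (sub_finite_set _ (finite_II N.+1)) => s /= gs.
rewrite ltnNge; apply/negP => Ns; move: gs => /negP; apply.
case: s Ns => // s; rewrite ltnS => Ns.
have /eqP eqs : pbw_weight rho v mu s == pbw_weight rho v mu s.+1.
  rewrite eqEdim mono //=.
  have /kmax/leq_trans -> // : P (\dim (pbw_weight rho v mu s.+1)).
    by apply/asboolP; exists s.+1.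
  by rewrite -dN dimvS // mono.
have := dimv_cap_compl (pbw_weight rho v mu s.+1) (pbw_weight rho v mu s).
by rewrite /gr_dim /= -eqs capvv => /eqP; rewrite -[X in _ == X]addn0 eqn_add2l.
Qed.

(* A sum over s \in A has as value the sum of its nonzero terms provided there
   are finitely many of them. This is the case here by [finite_gr_dim], in
   [gr_char] because V has finitely many weights, and for sums over the set
   [FFL m] because it is finite: every positive root is on a Dyck path. *)
Definition gr_weight_char rho v mu : {poly int} :=
  \sum_(s \in [set: nat]) (gr_dim rho v mu s)%:Z *: 'X^s.

(* Formal sums of the exponentials e^mu with coefficients in Z[q];
   << c *g mu >> is c e^mu. *)
Definition gr_char rho v : {malg {poly int}[weight n]} :=
  \sum_(mu \in [set: weight n]) << gr_weight_char rho v mu *g mu >>.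

End Representations.

(* Main.v *)
(* The monomials f^s v with s in S(lambda) form a basis of V(lambda), compatible
   with the PBW filtration and with the weights; this gives both formulas.

   Spanning. If x is a column and y a row with y x = 0, supported on the indices
   i, .., j + 1, then z = x y is nilpotent and z^M v = 0 for
   M > m_i + .. + m_j. Modulo lower filtration steps only the strictly lower
   triangular part of z contributes to z^M v, so comparing coefficients of
   monomials in the entries of x and y gives, for all row sums and column sums of
   total M, a relation with positive coefficients between the f^t v for which t has
   these margins. If s is supported on a Dyck path, it is the extreme point among
   the tables with its margins (north-west corner rule), so f^s v can be replaced
   by smaller terms.

   Independence. Linear relations between monomials are the same in V(lambda) and
   in the submodule generated by the highest weight vector w of a tensor product
   of exterior powers: one compares them in the cyclic module generated by
   (v, w) in the direct sum, using irreducibility on one side and a positive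
   definite contravariant form on the other. In the tensor product the coordinates
   of f^t w are explicit, and for s in S(lambda), written as a sum of antichains
   (Minkowski decomposition), there is a coordinate which is nonzero at f^s w and
   vanishes at f^t w for all other t that do not precede s. *)

From HB Require Import structures.
Require Import Defs.
From mathcomp Require Import all_boot all_order all_algebra.
From mathcomp Require Import finmap.
From mathcomp Require Import boolp classical_sets functions cardinality fsbigop.
From mathcomp Require Import reals.
From mathcomp Require Import complex.
From mathcomp Require Import monalg.
From mathcomp Require Import fingroup perm.
From mathcomp Require Import zify ring.

Set Implicit Arguments.
Unset Strict Implicit.
Unset Printing Implicit Defensive.

Import Order.TTheory GRing.Theory Num.Theory.
Local Open Scope ring_scope.

(** * Dyck paths and chains of roots *)

(** It is first proved for w: on e_0 /\ .. /\ e_k two applications of z already give zero, and one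
    does unless i <= k <= j, so each of the m_i + .. + m_j relevant tensor factors absorbs at most
    one z. The cyclic module of (v, w) contains no nonzero (a, 0) and no nonzero (0, b); the first
    fact brings z^M w = 0 back to v, the second carries linear relations from v to w. Two unrelated
    orders on exponents occur: the potential for straightening and a lexicographic weight for
    independence. They never have to be compared, because straightening respects degrees: the
    monomials of S(lambda) of degree at most d span the d-th filtration step, and independence of
    all of them turns these spanning sets into bases of all steps at once. Characteristic zero
    enters through the coefficients of the relations, which are positive integers and must be
    invertible. *)

Section Chains.
Variable n : nat.
Implicit Types (b c d : posroot n) (C : {set posroot n}) (m : {ffun 'I_n -> nat}).

Lemma root_fst_snd c : (root_fst c <= root_snd c)%N.
Proof. by case: c. Qed.

Lemma posroot_eqP c d :
  root_fst c = root_fst d -> root_snd c = root_snd d -> c = d.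
Proof. by case: c d => [[p q] ?] [[p' q'] ?]; rewrite /root_fst /root_snd /= => pp qq; apply: val_inj; rewrite /= pp qq. Qed.

Definition root_le c d : bool :=
  (root_fst c <= root_fst d)%N && (root_snd c <= root_snd d)%N.

Lemma root_le_refl : reflexive root_le.
Proof. by move=> c; rewrite /root_le !leqnn. Qed.

Lemma root_le_trans : transitive root_le.
Proof. by rewrite /root_le => d b c; lia. Qed.

Lemma root_le_anti c d : root_le c d -> root_le d c -> c = d.
Proof.
by rewrite /root_le => H K; apply: posroot_eqP; apply: val_inj => /=; lia.
Qed.

Definition is_chain C := forall c d, c \in C -> d \in C -> root_le c d || root_le d c.

Definition in_range (i j : 'I_n) c := (i <= root_fst c)%N && (root_snd c <= j)%N.

(** The second index is raised before the first; in this order every intermediate pair still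
    satisfies p <= q. *)
Lemma dyck_connect c d : root_le c d ->
  exists2 P, path (@dyck_step n) c P & last c P = d.
Proof.
have [k] := ubnP (root_snd d - root_snd c + (root_fst d - root_fst c))%N.
elim: k c => // k IH c; rewrite ltnS => lek /andP[le1 le2].
have [lt2|ge2] := ltnP (root_snd c) (root_snd d).
  have q1 : ((root_snd c).+1 < n)%N by have := ltn_ord (root_snd d); lia.
  have pq : (root_fst c <= Ordinal q1)%N by have /= := root_fst_snd c; lia.
  pose c1 : posroot n := exist _ (root_fst c, Ordinal q1) pq.
  have [||P pP lP] := IH c1.
  - by rewrite /c1 /root_snd /root_fst /= in lek le1 le2 lt2 *; lia.
  - by rewrite /root_le /= le1.
  exists (c1 :: P) => //=; rewrite pP andbT /dyck_step.
  by rewrite /c1 /root_fst /root_snd /= !eqxx.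
have [lt1|ge1] := ltnP (root_fst c) (root_fst d); last first.
  exists [::] => //=; apply: root_le_anti; rewrite /root_le; lia.
have p1 : ((root_fst c).+1 < n)%N by have := ltn_ord (root_fst d); lia.
have pq : (Ordinal p1 <= root_snd c)%N by have /= := root_fst_snd d; lia.
pose c1 : posroot n := exist _ (Ordinal p1, root_snd c) pq.
have [||P pP lP] := IH c1.
- by rewrite /c1 /root_snd /root_fst /= in lek le1 le2 ge2 lt1 *; lia.
- by rewrite /root_le /= le2 andbT.
exists (c1 :: P) => //=; rewrite pP andbT /dyck_step.
by rewrite /c1 /root_fst /root_snd /= !eqxx orbT.
Qed.

Lemma path_le_dyck c L : path root_le c L ->
  exists P, [/\ path (@dyck_step n) c P, last c P = last c L
    & {subset L <= c :: P}].
Proof.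
elim: L c => [|d L IH] c /=; first by exists [::].
move=> /andP[cd /IH[P [pP lP sP]]]; have [Q pQ lQ] := dyck_connect cd.
exists (Q ++ P); split; first by rewrite cat_path pQ lQ.
  by rewrite last_cat lQ.
have Qd : d \in c :: Q by rewrite -lQ mem_last.
move=> e; rewrite inE => /orP[/eqP ->|/sP]; first by rewrite -cat_cons mem_cat Qd.
by rewrite -cat_cons mem_cat inE => /orP[/eqP ->|->]; rewrite ?Qd ?orbT.
Qed.

Lemma leq_sum_subset (T : eqType) (f : T -> nat) (l l' : seq T) :
  uniq l -> {subset l <= l'} -> (\sum_(x <- l) f x <= \sum_(x <- l') f x)%N.
Proof.
elim: l l' => [|x l IH] l' /=; first by rewrite big_nil.
move=> /andP[xl ul] sl; have xl' : x \in l' by apply: sl; rewrite mem_head.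
rewrite big_cons (perm_big _ (perm_to_rem xl')) big_cons /= leq_add2l.
apply: IH => // y yl; have := sl y; rewrite inE yl orbT => /(_ isT) yl'.
have := perm_mem (perm_to_rem xl') y; rewrite yl' inE.
by have [yx|_] := eqVneq y x => // _; rewrite -yx yl in xl.
Qed.

Lemma dyck_path_le c P : path (@dyck_step n) c P ->
  path root_le c P && uniq (c :: P).
Proof.
move=> pP; have sub : subrel (@dyck_step n) (fun c d => root_le c d && (c != d)).
  move=> d e; rewrite /dyck_step /root_le => H; apply/andP; split.
    by have := root_fst_snd d; have := root_fst_snd e; move: H => /orP[/andP[/eqP -> /eqP ->]|/andP[/eqP -> /eqP ->]]; lia.
  apply/negP => /eqP de; move: H; rewrite de; lia.
have {}pP := sub_path sub pP; apply/andP; split.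
  by apply: sub_path pP => d e /andP[].
have -> : c :: P = map id (c :: P) by rewrite map_id.
apply: (sorted_uniq (leT := fun c d => root_le c d && (c != d))).
- move=> e d f /andP[de nde] /andP[ef nef]; rewrite (root_le_trans de ef) /=.
  by apply: contra nde => /eqP df; apply/eqP/root_le_anti => //; rewrite df.
- by move=> d; rewrite eqxx andbF.
- by rewrite map_id.
Qed.

Lemma FFL_chainP m s : FFL m s <-> forall (i j : 'I_n) C, is_chain C ->
  {in C, forall c, in_range i j c} ->
  (\sum_(c in C) s c <= \sum_(k < n | (i <= k <= j)%N) m k)%N.
Proof.
split=> [sm i j C chC rC|H i j b P].
  have [->|[c0 c0C]] := set_0Vmem C; first by rewrite big_set0.
  have /andP[ic0 c0j] := rC _ c0C; have c0pq := root_fst_snd c0.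
  pose L := sort root_le (enum C).
  have LC : L =i C by move=> c; rewrite mem_sort mem_enum.
  have sL : sorted root_le L.
    apply: (sort_sorted_in (P := mem C)) => [c d cC dC|]; first exact: chC.
    by apply/allP => c; rewrite mem_enum.
  have ib c : c \in C -> root_le (simple i) c && root_le c (simple j).
    move=> cC; have := rC _ cC; have := root_fst_snd c.
    by rewrite /in_range /root_le /simple /root_fst /root_snd /=; lia.
  have pL : path root_le (simple i) (rcons L (simple j)).
    have allL : all (fun c => root_le c (simple j)) L.
      by apply/allP => c; rewrite LC => /ib /andP[].
    rewrite (@path_sorted_inE _ predT) //; first 1 last.
    - by move=> c d e _ _ _; exact: root_le_trans.
    - by apply/allP.
    apply/andP; split.
      apply/allP => c; rewrite mem_rcons inE LC => /orP[/eqP ->|/ib /andP[] //].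
      by have /andP[_] := ib _ c0C; apply: root_le_trans; have /andP[] := ib _ c0C.
    case: (L) sL allL => //= c L'; rewrite rcons_path => -> /andP[cj al] /=.
    by have := mem_last c L'; rewrite inE => /orP[/eqP ->|/(allP al)].
  have [P [pP lP sP]] := path_le_dyck pL.
  rewrite last_rcons in lP.
  (* If i = j, a nontrivial path would come back to [simple i], but Dyck paths have no
     repetitions. *)
  have nP : nilp P || (i < j)%N.
    case: P pP lP {sP} => // d P pP lP; rewrite orFb ltn_neqAle.
    apply/andP; split; last lia.
    apply/negP => /eqP ij; have {ij} ij : i = j by apply: val_inj.
    have /andP[_ /andP[+ _]] := dyck_path_le pP.
    by rewrite ij -lP -[last _ _]/(last d P) mem_last.
  have := sm i j (simple i) P; rewrite /dyck_path eqxx lP eqxx nP pP => /(_ isT).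
  apply: leq_trans; rewrite -big_enum.
  apply: leq_sum_subset; first exact: enum_uniq.
  by move=> c; rewrite mem_enum -LC => cL; apply: sP; rewrite mem_rcons inE cL orbT.
move=> /and4P[/eqP -> /eqP lP _ pP]; have /andP[pLP uP] := dyck_path_le pP.
have sLP : sorted root_le (simple i :: P) by [].
rewrite (big_uniq _ uP) /=.
have -> : (\sum_(c in simple i :: P) s c = \sum_(c in [set c in simple i :: P]) s c)%N.
  by apply: eq_bigl => c; rewrite inE.
apply: H => [c d|c].
  rewrite !finset.in_set => cP dP.
  have idx := sorted_leq_index root_le_trans root_le_refl sLP.
  by have [/idx ->|/ltnW/idx ->] := leqP (index c (simple i :: P)) (index d (simple i :: P)); rewrite ?orbT.
rewrite finset.in_set => cP; have idx := sorted_leq_index root_le_trans root_le_refl sLP.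
have ic : root_le (simple i) c by apply: idx; rewrite ?mem_head //= eqxx.
have cj : root_le c (simple j).
  apply: idx; rewrite // -?lP ?mem_last // index_last // -ltnS.
  by rewrite -[(size _).+1]/(size (simple i :: P)) index_mem.
move: ic cj; rewrite /root_le /simple /root_fst /root_snd /= /in_range.
by move=> /andP[-> _] /andP[_ ->].
Qed.

End Chains.

(** * Minkowski decomposition of S(lambda) *)

Section Minkowski.
Variable n : nat.
Implicit Types (c d : posroot n) (C M : {set posroot n}) (m : {ffun 'I_n -> nat}).
Implicit Types (s : multiexp n).

Definition root_around (i : 'I_n) c := (root_fst c <= i <= root_snd c)%N.

Definition fund_antichain (i : 'I_n) M :=
  {in M, forall c, root_around i c} /\ {in M &, forall c d, root_le c d -> c = d}.

Lemma FFL_le m s c : FFL m s ->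
  (s c <= \sum_(k < n | (root_fst c <= k <= root_snd c)%N) m k)%N.
Proof.
move=> /FFL_chainP /(_ (root_fst c) (root_snd c) [set c]%SET).
rewrite big_set1; apply; first by move=> ? ? /set1P -> /set1P ->; rewrite root_le_refl.
by move=> ? /set1P ->; rewrite /in_range !leqnn.
Qed.

(* M consists of the minimal roots around i in the support of s. *)
Lemma FFL_peel m s (i : 'I_n) : FFL m s -> (0 < m i)%N ->
    (forall j : 'I_n, (j < i)%N -> m j = 0%N) ->
  exists M, [/\ fund_antichain i M, forall c, ((c \in M) <= s c)%N &
    FFL [ffun j => m j - (j == i)]%N [ffun c => s c - (c \in M)]%N].
Proof.
move=> sFFL mi0 mlt; have /FFL_chainP sm := sFFL.
pose A c := (0 < s c)%N && root_around i c.
pose M := [set c | A c && [forall d, A d && root_le d c ==> (d == c)]].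
have MA c : c \in M -> A c by rewrite inE => /andP[].
have Mmin c d : c \in M -> A d -> root_le d c -> d = c.
  by rewrite inE => /andP[_ /forallP/(_ d)/implyP H] Ad dc; apply/eqP/H/andP.
have belowM c : A c -> exists2 d, d \in M & root_le d c.
  have [k] := ubnP (root_fst c + root_snd c)%N; elim: k c => // k IH c lek Ac.
  have [cM|] := boolP (c \in M); first by exists c => //; exact: root_le_refl.
  rewrite inE Ac /= negb_forall => /existsP[d]; rewrite negb_imply.
  move=> /andP[/andP[Ad dc] ndc]; have [|e eM ed] := IH d _ Ad; last first.
    by exists e => //; exact: root_le_trans ed dc.
  have := ndc; rewrite ltnNge; apply: contra => H; apply/eqP.
  by apply: root_le_anti => //; move: dc H lek; rewrite /root_le; lia.
exists M; split.
- split=> [c /MA /andP[] //|c d cM dM cd]; apply: (Mmin) => //; exact: MA.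
- by move=> c; case: (boolP (c \in M)) => // /MA /andP[].
apply/FFL_chainP => a b C chC rC.
have [->|[c0 c0C]] := set_0Vmem C; first by rewrite big_set0.
have ab : (a <= b)%N by have := rC _ c0C; have := root_fst_snd c0; rewrite /in_range; lia.
have sub_le : (\sum_(c in C) ([ffun c => s c - (c \in M)]%N : multiexp n) c <= \sum_(c in C) s c)%N.
  by apply: leq_sum => c _; rewrite ffunE leq_subr.
have [/andP[ai ib]|nai] := boolP (a <= i <= b)%N; last first.
  apply: (leq_trans sub_le); apply: (leq_trans (sm a b C chC rC)).
  apply: leq_sum => k /andP[ak kb]; rewrite ffunE.
  have [ki|] := eqVneq k i; last by rewrite subn0.
  by rewrite -ki ak kb in nai.
have sum1 : ((\sum_(k < n | a <= k <= b) ([ffun j => m j - (j == i)]%N : {ffun 'I_n -> nat}) k).+1 =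
   \sum_(k < n | a <= k <= b) m k)%N.
  rewrite (bigD1 i) ?ai //= [RHS](bigD1 i) ?ai //= ffunE eqxx subn1 -addSn prednK //.
  congr (_ + _)%N; apply: eq_bigr => k /andP[_ /negPf ki].
  by rewrite ffunE ki subn0.
(* Suppose C breaks the lowered bound. Then s attains the old bound on C, and C cannot meet M, since
   a root of M in C would have lowered the sum over C as well. *)
rewrite -ltnS sum1 ltnNge; apply/negP => tight.
have CM0 c : c \in C -> c \notin M.
  move=> cC; apply/negP => cM.
  have s0 : (0 < s c)%N by have /MA /andP[] := cM.
  have lt : (\sum_(c in C) ([ffun c => s c - (c \in M)]%N : multiexp n) c < \sum_(c in C) s c)%N.
    rewrite (bigD1 c) //= [X in (_ < X)%N](bigD1 c) //= ffunE cM subn1 -addSn prednK //.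
    by rewrite leq_add2l; apply: leq_sum => d _; rewrite ffunE leq_subr.
  by have := leq_ltn_trans tight lt; rewrite ltnNge => /negP; apply; exact: sm.
have {}tight : (\sum_(k < n | a <= k <= b) m k <= \sum_(c in C) s c)%N.
  by apply: (leq_trans tight sub_le).
have low c : c \in C -> (0 < s c)%N -> (i <= root_snd c)%N.
  move=> cC sc0; rewrite leqNgt; apply/negP => ci.
  have := FFL_le c sFFL; rewrite big1 // => [|k kc]; last by apply: mlt; lia.
  by rewrite leqn0 eqn0Ngt sc0.
(* Otherwise the support of s in C lies in the range i + 1, .., b, whose bound is smaller by at
   least m_i > 0. *)
have [x0 [x0C sx0 x0i]] : exists c, [/\ c \in C, (0 < s c)%N & (root_fst c <= i)%N].
  apply: contrapT => nex.
  have hi c : c \in C -> (0 < s c)%N -> (i < root_fst c)%N.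
    by move=> cC sc; rewrite ltnNge; apply/negP => ci; apply: nex; exists c.
  pose C' := [set c in C | (0 < s c)%N].
  have sumC' : (\sum_(c in C) s c = \sum_(c in C') s c)%N.
    rewrite [RHS](eq_bigl (fun c => (c \in C) && (0 < s c)%N)); last by move=> c; rewrite inE.
    rewrite [RHS]big_mkcondr; apply: eq_bigr => c _; by case: (s c).
  have [C'0|[c1 c1C']] := set_0Vmem C'.
    move: tight; rewrite sumC' C'0 big_set0 -sum1; lia.
  have i1 : (i.+1 < n)%N.
    move: c1C'; rewrite inE => /andP[c1C sc1]; have := hi _ c1C sc1.
    by have := ltn_ord (root_fst c1); lia.
  have chC' : is_chain C'.
    by move=> c d; rewrite !inE => /andP[cC _] /andP[dC _]; exact: chC.
  have rC' : {in C', forall c, in_range (Ordinal i1) b c}.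
    move=> c; rewrite inE => /andP[cC sc]; have := hi _ cC sc.
    by have := rC _ cC; rewrite /in_range /=; lia.
  have le1 := sm _ _ _ chC' rC'; rewrite -sumC' in le1; have := leq_trans tight le1; rewrite leqNgt => /negP; apply.
  rewrite [X in (_ < X)%N](bigD1 i) ?ai //= -add1n leq_add //.
  rewrite big_mkcond [X in (_ <= X)%N]big_mkcond /=; apply: leq_sum => k _.
  case: ifP => [/andP[ik kb]|_ //]; rewrite ifT //.
  by rewrite (leq_trans ai (ltnW ik)) kb; apply/negP => /eqP E; rewrite E ltnn in ik.
(* The lowest root x of C around i lies above some y in M, and y is not in C. Adding y to the
   support of C gives a chain with a larger sum. Its range may start before a, but m vanishes below
   i, so the bound does not grow: a contradiction. *)
pose h c := (root_fst c + root_snd c)%N.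
case: (@arg_minnP _ x0 (fun c => (c \in C) && A c) h) => [|x].
  by rewrite x0C /A sx0 /root_around x0i low.
move=> /andP[xC Ax] xmin.
have [y yM yx] := belowM _ Ax.
pose a' := if (a <= root_fst y)%N then a else root_fst y.
pose D := y |: [set c in C | (0 < s c)%N].
have yD c : c \in C -> (0 < s c)%N -> root_le y c.
  move=> cC sc; have /orP[xc|cx] := chC _ _ xC cC; first exact: root_le_trans yx xc.
  have Ac : A c.
    rewrite /A sc /root_around low // andbT.
    by move: cx Ax; rewrite /root_le /A /root_around; lia.
  have := xmin c; rewrite cC Ac /h => /(_ isT) hc.
  by rewrite (@root_le_anti _ c x) //; move: cx hc; rewrite /root_le; lia.
have Ay := MA _ yM; have yi : (root_fst y <= i)%N by move: Ay; rewrite /A /root_around; lia.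
have chD : is_chain D.
  move=> c d; rewrite !inE => /orP[/eqP ->|/andP[cC sc]] /orP[/eqP ->|/andP[dC sd]].
  - by rewrite root_le_refl.
  - by rewrite yD.
  - by rewrite [X in _ || X]yD ?orbT.
  - exact: chC.
have rD : {in D, forall c, in_range a' b c}.
  move=> c; rewrite !inE /in_range /a' => /orP[/eqP ->|/andP[cC sc]].
    have := rC _ xC; move: yx; rewrite /root_le /in_range.
    by case: ifP => ?; lia.
  by have := rC _ cC; have := yD _ cC sc; rewrite /root_le /in_range; case: ifP => ?; lia.
have yC : y \notin C by apply/negP => /CM0; rewrite yM.
have := sm _ _ _ chD rD; rewrite big_setU1 /=; last by rewrite inE (negPf yC).
have -> : (\sum_(c in [set c in C | (0 < s c)%N]) s c = \sum_(c in C) s c)%N.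
  rewrite (eq_bigl (fun c => (c \in C) && (0 < s c)%N)); last by move=> c; rewrite inE.
  by rewrite big_mkcondr; apply: eq_bigr => c _; case: (s c).
have -> : (\sum_(k < n | a' <= k <= b) m k = \sum_(k < n | a <= k <= b) m k)%N.
  rewrite big_mkcond [RHS]big_mkcond; apply: eq_bigr => k _.
  have [ki|ik] := ltnP k i; first by rewrite mlt // !if_same.
  have -> : (a <= k)%N by exact: leq_trans ai ik.
  suff -> : (a' <= k)%N by [].
  by rewrite /a'; case: ifP => _; [exact: leq_trans ik|exact: leq_trans ik].
move: tight; have /andP[sy _] := Ay; lia.
Qed.

(** Peeling at the smallest i with m_i > 0, as [FFL_peel] demands, lowers the sum of m by one; when
    m = 0 the inequalities for single roots force s = 0. *)
Theorem FFL_minkowski m s : FFL m s ->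
  exists L : seq ('I_n * {set posroot n}),
    [/\ forall x, x \in L -> fund_antichain x.1 x.2,
        forall i, count (fun x => x.1 == i) L = m i &
        forall c, s c = (\sum_(x <- L) (c \in x.2))%N].
Proof.
have [k] := ubnP (\sum_i m i)%N; elim: k m s => // k IH m s; rewrite ltnS => lek sm.
have [m0|] := boolP [forall i, m i == 0%N].
  exists [::]; split=> // [i|c]; first by rewrite (eqP (forallP m0 i)).
  rewrite big_nil; apply/eqP; rewrite -leqn0.
  by have := FFL_le c sm; rewrite big1 // => i _; exact/eqP/(forallP m0).
rewrite negb_forall => /existsP[i1 mi1].
case: (@arg_minnP _ i1 (fun i => m i != 0%N) (fun i => val i) mi1) => i mi0 imin.
have mlt (j : 'I_n) : (j < i)%N -> m j = 0%N.
  by move=> ji; apply/eqP/negPn/negP => /imin; rewrite leqNgt ji.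
have [M [aM Ms]] := FFL_peel sm (etrans (lt0n _) mi0) mlt.
case/IH => [|L [aL cL sL]].
  rewrite (bigD1 i) //= ffunE eqxx; move: lek; rewrite (bigD1 i) //= => lek.
  rewrite (eq_bigr m); last by move=> j /negPf ji; rewrite ffunE ji subn0.
  by rewrite addnBAC ?lt0n // subn1 prednK // addn_gt0 lt0n mi0.
exists ((i, M) :: L); split.
- by move=> x; rewrite inE => /orP[/eqP ->|/aL].
- move=> j /=; rewrite cL ffunE eq_sym; case: eqVneq => [->|]; last by rewrite subn0.
  by rewrite subnKC // lt0n.
- by move=> c; rewrite big_cons -sL ffunE subnKC.
Qed.

End Minkowski.

(** * Two extremal properties of chains and antichains *)

Section TailSums.
Variable n : nat.
Implicit Types (c d : posroot n) (s t : posroot n -> nat).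

Definition tail_sum t (a b : nat) : nat :=
  (\sum_(c | (a <= root_fst c) && (b <= root_snd c)) t c)%N.

(** One number for the whole family of tail sums. It is additive in t, so a comparison survives
    adding a common exponent; [straighten] relies on this. *)
Definition potential t : nat := (\sum_(a < n.+1) \sum_(b < n.+1) tail_sum t a b)%N.

Lemma potentialD s t u : (forall c, u c = s c + t c)%N ->
  potential u = (potential s + potential t)%N.
Proof.
move=> uE; rewrite /potential -big_split; apply: eq_bigr => a _.
rewrite -big_split; apply: eq_bigr => b _; rewrite -big_split.
by apply: eq_bigr => c _; rewrite uE.
Qed.

Lemma tail_sum_fst s t a :
    (forall p : 'I_n, \sum_(c | root_fst c == p) t c = \sum_(c | root_fst c == p) s c)%N ->
  (\sum_(c | (a <= root_fst c)%N) t c = \sum_(c | (a <= root_fst c)%N) s c)%N.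
Proof.
move=> H; rewrite (partition_big (@root_fst n) (fun p => (a <= p)%N)) //=.
rewrite [RHS](partition_big (@root_fst n) (fun p => (a <= p)%N)) //=.
apply: eq_bigr => p ap; have := H p.
have E : (fun c => (a <= root_fst c)%N && (root_fst c == p)) =1 (fun c => root_fst c == p).
  by move=> c; case: eqP => [->|]; rewrite ?ap ?andbF.
by rewrite (eq_bigl _ _ E) [X in _ -> _ = X](eq_bigl _ _ E).
Qed.

Lemma tail_sum_snd s t a :
    (forall p : 'I_n, \sum_(c | root_snd c == p) t c = \sum_(c | root_snd c == p) s c)%N ->
  (\sum_(c | (a <= root_snd c)%N) t c = \sum_(c | (a <= root_snd c)%N) s c)%N.
Proof.
move=> H; rewrite (partition_big (@root_snd n) (fun p => (a <= p)%N)) //=.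
rewrite [RHS](partition_big (@root_snd n) (fun p => (a <= p)%N)) //=.
apply: eq_bigr => p ap; have := H p.
have E : (fun c => (a <= root_snd c)%N && (root_snd c == p)) =1 (fun c => root_snd c == p).
  by move=> c; case: eqP => [->|]; rewrite ?ap ?andbF.
by rewrite (eq_bigl _ _ E) [X in _ -> _ = X](eq_bigl _ _ E).
Qed.

(** Inclusion-exclusion with the negative terms moved across; it recovers t from its tail sums. *)
Lemma tail_sum_diff t (c : posroot n) :
  (t c + tail_sum t (root_fst c).+1 (root_snd c) + tail_sum t (root_fst c) (root_snd c).+1 =
   tail_sum t (root_fst c) (root_snd c) + tail_sum t (root_fst c).+1 (root_snd c).+1)%N.
Proof.
have E a b : tail_sum t a b =
    (\sum_d ((a <= root_fst d)%N && (b <= root_snd d)%N) * t d)%N.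
  by rewrite /tail_sum big_mkcond; apply: eq_bigr => d _; rewrite mulnbl.
have -> : t c = (\sum_d (d == c) * t d)%N.
  by rewrite (bigD1 c) //= eqxx mul1n big1 ?addn0 // => d /negPf ->; rewrite mul0n.
rewrite !E -!big_split /=; apply: eq_bigr => d _; rewrite -!mulnDl; congr (_ * _)%N.
have -> : (d == c) = (root_fst d == root_fst c :> nat) && (root_snd d == root_snd c :> nat).
  apply/eqP/andP => [->|[/eqP f /eqP g]]; first by rewrite !eqxx.
  by apply: posroot_eqP; apply: val_inj.
by do 2 case: ltngtP.
Qed.

(* Among all exponents with given row and column sums, the one supported on a
   chain has the largest tail sums (the "north-west corner rule"). *)
Lemma tail_sum_chain s t a b :
    (forall p : 'I_n, \sum_(c | root_fst c == p) t c = \sum_(c | root_fst c == p) s c)%N ->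
    (forall p : 'I_n, \sum_(c | root_snd c == p) t c = \sum_(c | root_snd c == p) s c)%N ->
    (forall c d, (0 < s c)%N -> (0 < s d)%N -> root_le c d || root_le d c) ->
  (tail_sum t a b <= tail_sum s a b)%N.
Proof.
move=> row col ch.
(* If a root of the support starts at a or later and ends before b, then by comparability every root
   of the support ending at b or later also starts at a or later, so the tail sum of s is a full sum
   of columns. Otherwise it is a full sum of rows. Both are upper bounds for the tail sum of t. *)
have [/existsP[c1 /and3P[s1 ac1 c1b]]|noc] :=
  boolP [exists c, [&& (0 < s c)%N, (a <= root_fst c)%N & (root_snd c < b)%N]].
  have -> : tail_sum s a b = (\sum_(c | (b <= root_snd c)%N) s c)%N.
    rewrite /tail_sum big_mkcond [RHS]big_mkcond; apply: eq_bigr => c _.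
    case: (posnP (s c)) => [->|sc]; first by rewrite !if_same.
    have [bc|bc] := leqP b (root_snd c); have [ca|ca] := leqP a (root_fst c) => //=.
    by have := ch _ _ s1 sc; rewrite /root_le; lia.
  rewrite -(tail_sum_snd b col) /tail_sum [X in (X <= _)%N]big_mkcond [X in (_ <= X)%N]big_mkcond.
  by apply: leq_sum => c _; case: (a <= _)%N; case: (b <= _)%N.
have -> : tail_sum s a b = (\sum_(c | (a <= root_fst c)%N) s c)%N.
  rewrite /tail_sum big_mkcond [RHS]big_mkcond; apply: eq_bigr => c _.
  case: (posnP (s c)) => [->|sc]; first by rewrite !if_same.
  have [ca|ca] := leqP a (root_fst c); have [bc|bc] := leqP b (root_snd c) => //=.
  by case/negP: noc; apply/existsP; exists c; rewrite sc ca bc.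
rewrite -(tail_sum_fst a row) /tail_sum [X in (X <= _)%N]big_mkcond [X in (_ <= X)%N]big_mkcond.
by apply: leq_sum => c _; case: (a <= _)%N; case: (b <= _)%N.
Qed.

(** All tail sums of s dominate those of t, so equal potentials force equal tail sums, and
    [tail_sum_diff] gives t = s. The potential sums over indices up to n because [tail_sum_diff]
    uses successors of root indices. *)
Lemma potential_chain s t :
    (forall p : 'I_n, \sum_(c | root_fst c == p) t c = \sum_(c | root_fst c == p) s c)%N ->
    (forall p : 'I_n, \sum_(c | root_snd c == p) t c = \sum_(c | root_snd c == p) s c)%N ->
    (forall c d, (0 < s c)%N -> (0 < s d)%N -> root_le c d || root_le d c) ->
  t =1 s \/ (potential t < potential s)%N.
Proof.
move=> row col ch; have le a b := tail_sum_chain a b row col ch.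
have le2 (a : 'I_n.+1) : true ->
    (\sum_(b < n.+1) tail_sum t a b <= \sum_(b < n.+1) tail_sum s a b)%N.
  by move=> _; apply: leq_sum.
rewrite ltn_neqAle [X in _ && X]leq_sum // andbT.
have [E|] := eqVneq (potential t) (potential s); [left|by right].
suff T (a b : 'I_n.+1) : tail_sum t a b = tail_sum s a b.
  move=> c; have := tail_sum_diff t c; have := tail_sum_diff s c.
  have p1 : (root_fst c < n.+1)%N by rewrite ltnW // ltnS.
  have q1 : (root_snd c < n.+1)%N by rewrite ltnW // ltnS.
  have p2 : ((root_fst c).+1 < n.+1)%N by rewrite ltnS.
  have q2 : ((root_snd c).+1 < n.+1)%N by rewrite ltnS.
  have := T (Ordinal p1) (Ordinal q1); have := T (Ordinal p2) (Ordinal q1).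
  have := T (Ordinal p1) (Ordinal q2); have := T (Ordinal p2) (Ordinal q2).
  by move=> /= -> -> -> ->; lia.
apply/eqP; rewrite eqn_leq le leqNgt; apply/negP => lt.
suff : (potential t < potential s)%N by rewrite E ltnn.
rewrite /potential (bigD1 a) //= [X in (_ < X)%N](bigD1 a) //= -addSn leq_add //.
  rewrite (bigD1 b) //= [X in (_ < X)%N](bigD1 b) //= -addSn leq_add //.
  exact: leq_sum.
by apply: leq_sum => a' _; exact: le2.
Qed.

End TailSums.

(** * Lexicographic weights and nested targets *)

Section Triangularity.
Variables (n : nat).

(* The base exceeds the number of terms below, so these weights compare exponents
   lexicographically: first by the smallest row, then by the longest root. *)
Definition lex_weight (b a : nat) : nat :=
  if (b < a)%N then (n.+2 ^ ((n - b) * n.+1 + a))%N else 0%N.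

(** Let b be the smallest index moved by sg. Smaller rows contribute equally to both sides. The
    identity gives row b the target g b, whereas sg gives it the target g p with p = sg^-1 b > b,
    and g p < g b by nestedness (or because g p = p <= k). Hence the leading power drops. *)
Lemma nested_perm_max (k : 'I_n) (g : 'I_n.+1 -> 'I_n.+1) (sg : {perm 'I_n.+1}) :
    (forall i : 'I_n.+1, (i <= k)%N -> g i = i \/ (k < g i)%N) ->
    (forall i j : 'I_n.+1, (i < j)%N -> (j <= k)%N -> (k < g i)%N -> (k < g j)%N ->
      (g j < g i)%N) ->
    (forall i : 'I_n.+1, (k < i)%N -> sg i = i) ->
    (forall i : 'I_n.+1, (i <= k)%N -> (sg i <= g i)%N) ->
  sg = 1%g \/
  (\sum_(i < n.+1 | (i <= k)%N) lex_weight (sg i) (g i)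
     < \sum_(i < n.+1 | (i <= k)%N) lex_weight i (g i))%N.
Proof.
move=> gk gdec sgk sgle.
have [/forallP sg1|] := boolP [forall i, sg i == i].
  by left; apply/permP => i; rewrite perm1; apply/eqP.
rewrite negb_forall => /existsP[b0 nb0]; right.
case: (@arg_minnP _ b0 (fun i => sg i != i) (fun i => val i) nb0) => b nb bmin.
have fixb (i : 'I_n.+1) : (i < b)%N -> sg i = i.
  by move=> ib; apply/eqP/negPn/negP => /bmin; rewrite leqNgt ib.
have bk : (b <= k)%N by rewrite leqNgt; apply/negP => /sgk E; rewrite E eqxx in nb.
have geb (i : 'I_n.+1) : (b <= i)%N -> (b <= sg i)%N.
  move=> bi; rewrite leqNgt; apply/negP => sib.
  by have /perm_inj E := fixb _ sib; move: bi; rewrite -E leqNgt sib.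
have kgb : (k < g b)%N.
  have [gb|//] := gk b bk; have := sgle b bk; rewrite gb => H.
  by case/eqP: nb; apply: val_inj; apply/eqP; rewrite eqn_leq H geb.
pose p := (sg^-1)%g b; have sp : sg p = b by rewrite permKV.
have np : p != b by apply: contraNneq nb => E; rewrite -{1}E sp.
have bp : (b < p)%N.
  rewrite ltn_neqAle eq_sym val_eqE np leqNgt; apply/negP => pb.
  by have := fixb _ pb; rewrite sp => E; rewrite -E ltnn in pb.
have pk : (p <= k)%N.
  by rewrite leqNgt; apply/negP => kp; have := sgk _ kp; rewrite sp => E; move: kp; rewrite -E ltnNge bk.
have gpb : (g p < g b)%N.
  by have [->|kgp] := gk p pk; [exact: leq_ltn_trans pk kgb|exact: gdec].
rewrite (bigID (fun i : 'I_n.+1 => (i < b)%N)) [X in (_ < X)%N](bigID (fun i : 'I_n.+1 => (i < b)%N)) /=.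
rewrite (eq_bigr (fun i => lex_weight (val i) (g i))); last first.
  by move=> i /andP[_ /fixb ->].
rewrite ltn_add2l [X in (_ < X)%N](bigD1 b) /=; last by rewrite bk ltnn.
apply: leq_trans (leq_addr _ _); rewrite {2}/lex_weight (leq_ltn_trans bk kgb).
have Epos : (0 < (n - b) * n.+1 + g b)%N by rewrite addn_gt0 (leq_ltn_trans (leq0n k) kgb) orbT.
rewrite -(prednK Epos) expnS.
(* At most n + 1 terms remain, each bounded by the base n + 2 raised to one less than the leading
   exponent. *)
apply: (@leq_ltn_trans (\sum_(i < n.+1) n.+2 ^ ((n - b) * n.+1 + g b).-1)%N); last first.
  by rewrite sum_nat_const card_ord ltn_mul2r expn_gt0 ltnSn.
rewrite big_mkcond leq_sum // => i _; case: ifP => // /andP[ik].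
rewrite -leqNgt => bi; rewrite /lex_weight; case: ifP => // lt.
rewrite leq_exp2l //.
(* Row b is now reached from p, with a smaller target; a row beyond b loses a full n + 1 in the
   exponent, more than any target can restore. *)
have [E|nE] := eqVneq (sg i) b.
  have -> : i = p by apply: (@perm_inj _ sg); rewrite sp.
  rewrite sp; lia.
have lt2 : (b < sg i)%N by rewrite ltn_neqAle eq_sym val_eqE nE geb.
have sn : (sg i <= n)%N by rewrite -ltnS.
have gn : (g i <= n)%N by rewrite -ltnS.
have -> : (n - b = (n - sg i) + (sg i - b).-1.+1)%N by lia.
rewrite mulnDl mulSn; nia.
Qed.

End Triangularity.

(** * A tensor product of exterior powers *)

Section TensorModel.
Variables (F : numClosedFieldType) (n : nat) (L : finType) (k : L -> 'I_n).

Local Notation position := (L * 'I_n.+1)%type.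
Local Notation state := {ffun position -> 'I_n.+1}.
Local Notation tensor := {ffun state -> F^o}.

(* The factor l of the tensor product is the (k l + 1)-st tensor power of the
   standard representation: matrices act on the positions (l, i) with i <= k l
   and trivially on the others. *)
Definition active (p : position) : bool := (p.2 <= k p.1)%N.

Implicit Types (p q : position) (g h : state) (u v w : tensor) (A B : 'M[F]_n.+1).

Definition upd g p (c : 'I_n.+1) : state := [ffun q => if q == p then c else g q].

Lemma upd_same g p c : upd g p c p = c.
Proof. by rewrite ffunE eqxx. Qed.

Lemma upd_other g p c q : q != p -> upd g p c q = g q.
Proof. by rewrite ffunE => /negPf ->. Qed.

Lemma upd_upd g p c d : upd (upd g p c) p d = upd g p d.
Proof. by apply/ffunP => q; rewrite !ffunE; case: eqP. Qed.

Lemma upd_comm g p q c d : p != q -> upd (upd g p c) q d = upd (upd g q d) p c.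
Proof.
move=> pq; apply/ffunP => r; rewrite !ffunE.
by have [->|//] := eqVneq r q; rewrite eq_sym (negPf pq).
Qed.

Lemma upd_id g p : upd g p (g p) = g.
Proof. by apply/ffunP => q; rewrite ffunE; case: eqP => [->|]. Qed.

(** The derivation action on a tensor power, in coordinates: A is applied to one active position at
    a time. *)
Definition tact A u : tensor :=
  [ffun g : state => \sum_(p | active p) \sum_c A (g p) c * u (upd g p c)].

Lemma tactDl a A B u : tact (a *: A + B) u = a *: tact A u + tact B u.
Proof.
apply/ffunP => g; rewrite !ffunE scaler_sumr -big_split; apply: eq_bigr => p _.
rewrite scaler_sumr -big_split; apply: eq_bigr => c _.
by rewrite !mxE mulrDl /= -mulrA.
Qed.

Lemma tactDr A a u v : tact A (a *: u + v) = a *: tact A u + tact A v.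
Proof.
apply/ffunP => g; rewrite !ffunE scaler_sumr -big_split; apply: eq_bigr => p _.
rewrite scaler_sumr -big_split; apply: eq_bigr => c _.
by rewrite !ffunE mulrDr /= /GRing.scale /= mulrCA.
Qed.

(** Actions at different positions commute, so only the diagonal terms p = q survive in the
    commutator. *)
Lemma tact_bracket A B u :
  tact (A *m B - B *m A) u = tact A (tact B u) - tact B (tact A u).
Proof.
apply/ffunP => g; rewrite !ffunE.
pose T A B p q : F := \sum_c \sum_d A (g p) c * (B (upd g p c q) d * u (upd (upd g p c) q d)).
have E A' B' : \sum_(p | active p) \sum_c A' (g p) c * tact B' u (upd g p c) =
    \sum_(p | active p) \sum_(q | active q) T A' B' p q.
  apply: eq_bigr => p _; rewrite exchange_big /=; apply: eq_bigr => c _.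
  rewrite ffunE mulr_sumr; apply: eq_bigr => q _.
  by rewrite mulr_sumr.
rewrite !E [X in _ = _ - X]exchange_big /= -sumrB; apply: eq_bigr => p ap.
rewrite -sumrB (bigD1 p) //= [X in _ = _ + X]big1 ?addr0 => [|q /andP[_ qp]]; last first.
  apply/eqP; rewrite subr_eq0; apply/eqP; rewrite /T exchange_big /=.
  apply: eq_bigr => d _; apply: eq_bigr => c _.
  by rewrite upd_other // upd_other 1?eq_sym // upd_comm 1?eq_sym // mulrCA.
have TE A' B' : T A' B' p p = \sum_d (A' *m B') (g p) d * u (upd g p d).
  rewrite /T exchange_big; apply: eq_bigr => d _.
  rewrite mxE mulr_suml; apply: eq_bigr => c _.
  by rewrite upd_same upd_upd mulrA.
rewrite !TE -sumrB; apply: eq_bigr => d _.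
by rewrite !mxE mulrDl mulNr.
Qed.

Definition dot u v : F := \sum_g u g * (v g)^*.

Lemma dotDl a u v w : dot (a *: u + v) w = a * dot u w + dot v w.
Proof.
rewrite /dot mulr_sumr -big_split; apply: eq_bigr => g _.
by rewrite !ffunE mulrDl mulrA.
Qed.

Lemma dotDr a u v w : dot u (a *: v + w) = a^* * dot u v + dot u w.
Proof.
rewrite /dot mulr_sumr -big_split; apply: eq_bigr => g _.
by rewrite !ffunE rmorphD rmorphM /=; ring.
Qed.

Lemma dot_eq0 u : dot u u = 0 -> u = 0.
Proof.
move=> /eqP; rewrite psumr_eq0 => [/allP H|g _]; last exact: mul_conjC_ge0.
apply/ffunP => g; rewrite ffunE; apply/eqP.
by have := H g (mem_index_enum _); rewrite /= mul_conjC_eq0.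
Qed.

Definition adjmx A : 'M[F]_n.+1 := \matrix_(i, j) (A j i)^*.

Lemma dot_tact A u v : dot (tact A u) v = dot u (tact (adjmx A) v).
Proof.
rewrite /dot; under eq_bigr do rewrite ffunE mulr_suml.
under [RHS]eq_bigr do rewrite ffunE rmorph_sum mulr_sumr.
rewrite exchange_big [RHS]exchange_big; apply: eq_bigr => p _.
under eq_bigr do rewrite mulr_suml.
under [RHS]eq_bigr do rewrite rmorph_sum mulr_sumr.
rewrite !pair_big /=.
(* Exchanging the entry at p with the summation index c is an involution that matches the terms of
   the two sides. *)
pose f (x : state * 'I_n.+1) := (upd x.1 p x.2, x.1 p).
have fK : cancel f f.
  by move=> [g c]; rewrite /f /= upd_upd upd_id upd_same.
rewrite (reindex_inj (can_inj fK)) /=; apply: eq_bigr => -[g c] _ /=.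
rewrite upd_upd upd_id upd_same mxE rmorphM /= conjCK; ring.
Qed.

End TensorModel.

(** * One exterior power, realized by minors *)

Section FundamentalFactor.
Variables (F : numClosedFieldType) (n : nat) (k : 'I_n).
Local Notation block := {ffun 'I_n.+1 -> 'I_n.+1}.
Implicit Types (U A : 'M[F]_n.+1) (g : block) (i j : 'I_n.+1) (x : 'cV[F]_n.+1) (y : 'rV[F]_n.+1).

(* The leading minor of size k + 1 on the rows g 0, .., g k. The rows beyond k are
   frozen, so that the minors of all sizes live on the same index type. *)
Definition minor_mx U g : 'M[F]_n.+1 :=
  \matrix_(i, j) if (i <= k)%N then U (g i) j else (i == j)%:R.

(** As a function of g, these are the coordinates of the wedge product of columns 0, .., k of U,
    viewed as an antisymmetric tensor. *)
Definition minor U g : F := \det (minor_mx U g).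

Definition block_upd g i c : block := [ffun j => if j == i then c else g j].

Definition col_rep U j (x : 'cV[F]_n.+1) : 'M[F]_n.+1 :=
  \matrix_(a, c) if c == j then x a 0 else U a c.

Definition bact A (f : block -> F) g : F :=
  \sum_(i < n.+1 | (i <= k)%N) \sum_c A (g i) c * f (block_upd g i c).

Lemma cofactor_frozen U g i j : (i <= k)%N -> (k < j)%N ->
  cofactor (minor_mx U g) i j = 0.
Proof.
move=> ik kj; have ij : i != j by apply: contraTneq ik => ->; rewrite -ltnNge.
rewrite /cofactor; have [j' jE _] := unlift_some ij.
rewrite (expand_det_row _ j') big1 ?mulr0 // => c _.
by rewrite !mxE -jE leqNgt kj /= (negPf (neq_lift _ _)) mul0r.
Qed.

Lemma minor_col_rep U g j x : (j <= k)%N ->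
  minor (col_rep U j x) g =
  \sum_(i < n.+1 | (i <= k)%N) x (g i) 0 * cofactor (minor_mx U g) i j.
Proof.
move=> jk; rewrite /minor (expand_det_col _ j) [RHS]big_mkcond; apply: eq_bigr => i _.
rewrite !mxE; case: leqP => [ik|ki]; last first.
  by rewrite (_ : i == j = false) ?mul0r //; apply/negbTE; apply: contraTneq ki => ->; rewrite -leqNgt.
rewrite eqxx; congr (_ * _); rewrite /cofactor; congr (_ * \det _).
by apply/matrixP => a b; rewrite !mxE eq_sym (negPf (neq_lift _ _)).
Qed.

Lemma minor_upd U g i c : (i <= k)%N ->
  minor U (block_upd g i c) = \sum_j U c j * cofactor (minor_mx U g) i j.
Proof.
move=> ik; rewrite /minor (expand_det_row _ i); apply: eq_bigr => j _.
rewrite !mxE ik ffunE eqxx; congr (_ * _); rewrite /cofactor; congr (_ * \det _).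
by apply/matrixP => a b; rewrite !mxE ffunE eq_sym (negPf (neq_lift _ _)).
Qed.

(** The Leibniz rule for a wedge product: A acts by differentiating one column at a time. Both sides
    are the same sum of entries of A U times cofactors, grouped by rows or by columns. *)
Lemma bact_minor A U g :
  bact A (minor U) g = \sum_(j < n.+1 | (j <= k)%N) minor (col_rep U j (A *m col j U)) g.
Proof.
rewrite (eq_bigr _ (fun j jk => minor_col_rep U g (A *m col j U) jk)) [RHS]exchange_big.
apply: eq_bigr => i ik. 
transitivity (\sum_c \sum_j A (g i) c * (U c j * cofactor (minor_mx U g) i j)).
  by apply: eq_bigr => c _; rewrite minor_upd // mulr_sumr.
rewrite exchange_big [RHS]big_mkcond /=; apply: eq_bigr => j _.
case: leqP => [jk|kj]; last first.
  by rewrite big1 // => c _; rewrite cofactor_frozen // !mulr0.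
by rewrite mxE mulr_suml; apply: eq_bigr => c _; rewrite mxE mulrA.
Qed.

(** Here x lies in the span of e_0, .., e_k, and only its e_j component survives in the wedge. The
    computation is Cramer's rule: adj M applied to M x is det M times x. *)
Lemma minor_col_rep1 g j x : (j <= k)%N -> (forall a : 'I_n.+1, (k < a)%N -> x a 0 = 0) ->
  minor (col_rep 1%:M j x) g = x j 0 * minor 1%:M g.
Proof.
move=> jk xk; rewrite minor_col_rep //; set M := minor_mx _ _.
have -> : \sum_(i < n.+1 | (i <= k)%N) x (g i) 0 * cofactor M i j = (\adj M *m (M *m x)) j 0.
  rewrite mxE big_mkcond; apply: eq_bigr => i _; rewrite 2!mxE mulrC.
  case: leqP => [ik|ki].
    congr (_ * _); rewrite (bigD1 (g i)) //= big1 ?addr0 => [|c /negPf cg].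
      by rewrite !mxE ik eqxx mul1r.
    by rewrite !mxE ik eq_sym cg mul0r.
  rewrite big1 ?mulr0 // => c _; rewrite mxE leqNgt ki /=.
  by have [<-|_] := eqVneq i c; [rewrite xk // mulr0|rewrite mul0r].
by rewrite mulmxA mul_adj_mx mul_scalar_mx mxE mulrC.
Qed.

Lemma bact_upper A g : (forall i j, (j < i)%N -> A i j = 0) ->
  bact A (minor 1%:M) g = (\sum_(j < n.+1 | (j <= k)%N) A j j) * minor 1%:M g.
Proof.
move=> Aup; rewrite bact_minor mulr_suml; apply: eq_bigr => j jk.
have colA a : (A *m col j 1%:M) a 0 = A a j by rewrite colE mul1mx -colE mxE.
by rewrite minor_col_rep1 ?colA // => a ka; rewrite colA Aup //; exact: leq_ltn_trans ka.
Qed.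

Definition rank1_minor (x : 'cV[F]_n.+1) (y : 'rV[F]_n.+1) g : F :=
  \sum_(j < n.+1 | (j <= k)%N) y 0 j * minor (col_rep 1%:M j x) g.

Lemma minor_col_repZ U j x a g : (j <= k)%N ->
  minor (col_rep U j (a *: x)) g = a * minor (col_rep U j x) g.
Proof.
move=> jk; rewrite !minor_col_rep // mulr_sumr; apply: eq_bigr => i _.
by rewrite mxE mulrA.
Qed.

Lemma rank1_col (x : 'cV[F]_n.+1) (y : 'rV[F]_n.+1) (u : 'cV[F]_n.+1) :
  x *m y *m u = (y *m u) 0 0 *: x.
Proof.
by rewrite -mulmxA {1}[y *m u]mx11_scalar mul_mx_scalar.
Qed.

Lemma bact_rank1 x y g : bact (x *m y) (minor 1%:M) g = rank1_minor x y g.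
Proof.
rewrite bact_minor; apply: eq_bigr => j jk.
by rewrite rank1_col minor_col_repZ // colE mul1mx -colE mxE.
Qed.

(** After one application some wedge factor is x. A second application either hits that factor,
    giving y x = 0, or puts x into another factor, so that x occurs twice. *)
Lemma bact_rank1_rank1 x y g : y *m x = 0 -> bact (x *m y) (rank1_minor x y) g = 0.
Proof.
move=> yx.
have -> : bact (x *m y) (rank1_minor x y) g =
    \sum_(j < n.+1 | (j <= k)%N) y 0 j * bact (x *m y) (minor (col_rep 1%:M j x)) g.
  under [RHS]eq_bigr do rewrite mulr_sumr.
  rewrite exchange_big; apply: eq_bigr => i _.
  under [RHS]eq_bigr do rewrite mulr_sumr.
  rewrite exchange_big; apply: eq_bigr => c _.
  by rewrite mulr_sumr; apply: eq_bigr => j _; rewrite mulrCA.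
rewrite big1 // => j jk; rewrite bact_minor big1 ?mulr0 // => j' jk'.
rewrite rank1_col minor_col_repZ //.
have [->|jj'] := eqVneq j' j.
  have -> : col j (col_rep 1%:M j x) = x.
    by apply/matrixP => a b; rewrite !mxE eqxx ord1.
  by rewrite yx mxE mul0r.
rewrite minor_col_rep //; set M := minor_mx _ _.
(* The minor with x in the two columns j and j' is an off-diagonal entry of adj M M, hence zero. *)
have -> : \sum_(i < n.+1 | (i <= k)%N) x (g i) 0 * cofactor M i j' = (\adj M *m M) j' j.
  rewrite mxE big_mkcond; apply: eq_bigr => i _; rewrite !mxE eqxx mulrC.
  case: leqP => // ki; rewrite (_ : i == j = false) ?mulr0 //.
  by apply/negbTE; apply: contraTneq ki => ->; rewrite -leqNgt.
by rewrite mul_adj_mx [X in _ * X]mxE (negPf jj') mulr0n mulr0.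
Qed.

Lemma rank1_minor_eq0l x y g : (forall j, (j <= k)%N -> y 0 j = 0) ->
  rank1_minor x y g = 0.
Proof. by move=> y0; rewrite /rank1_minor big1 // => j /y0 ->; rewrite mul0r. Qed.

(** When x lies in the span of e_0, .., e_k, the matrix x y multiplies e_0 /\ .. /\ e_k by its trace
    on that span, which is y x. *)
Lemma rank1_minor_eq0r x y g : y *m x = 0 -> (forall j, (k < j)%N -> x j 0 = 0) ->
  rank1_minor x y g = 0.
Proof.
move=> yx x0; rewrite /rank1_minor.
under eq_bigr => j jk do rewrite minor_col_rep1 // mulrA.
rewrite -mulr_suml; suff -> : \sum_(j < n.+1 | (j <= k)%N) y 0 j * x j 0 = (y *m x) 0 0.
  by rewrite yx mxE mul0r.
by rewrite mxE big_mkcond; apply: eq_bigr => j _; case: leqP => // /x0 ->; rewrite mulr0.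
Qed.

End FundamentalFactor.

(** * Pure tensors and the highest weight vector of the tensor product *)

Section HighestWeightVector.
Variables (F : numClosedFieldType) (n : nat) (L : finType) (k : L -> 'I_n).
Local Notation block := {ffun 'I_n.+1 -> 'I_n.+1}.
Local Notation position := (L * 'I_n.+1)%type.
Local Notation state := {ffun position -> 'I_n.+1}.
Local Notation tensor := {ffun state -> F^o}.
Local Notation tact := (@tact F n L k).

HB.instance Definition _ A := GRing.isLinear.Build F tensor tensor *:%R (tact A) (tactDr k A).

Implicit Types (A : 'M[F]_n.+1) (f : L -> block -> F).

Definition slice (g : state) (l : L) : block := [ffun i => g (l, i)].

Definition prodv (f : L -> block -> F) : tensor := [ffun g : state => \prod_l f l (slice g l)].

Lemma slice_upd g l i c l' :
  slice (upd g (l, i) c) l' = if l' == l then block_upd (slice g l) i c else slice g l'.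
Proof.
apply/ffunP => j; rewrite !ffunE xpair_eqE.
by case: eqVneq => [->|]; rewrite ?ffunE.
Qed.

Lemma tact_prodv A f : tact A (prodv f) =
  \sum_l prodv (fun l' => if l' == l then bact (k l) A (f l) else f l').
Proof.
apply/ffunP => g; rewrite sum_ffunE !ffunE /=.
transitivity (\sum_l \sum_(i < n.+1 | (i <= k l)%N) \sum_c A (g (l, i)) c * prodv f (upd g (l, i) c)).
  by rewrite [RHS]pair_big_dep /=; apply: eq_big => [[l i]|[l i] _]; rewrite /active.
apply: eq_bigr => l _; rewrite ffunE (bigD1 l) //= eqxx.
under [X in _ * X]eq_bigr => l' /negPf l'l do rewrite l'l.
rewrite mulr_suml; apply: eq_bigr => i _; rewrite mulr_suml; apply: eq_bigr => c _.
rewrite ffunE (bigD1 l) //= slice_upd eqxx -mulrA ffunE; congr (_ * (_ * _)).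
by apply: eq_bigr => l' /negPf l'l; rewrite slice_upd l'l.
Qed.

Lemma eq_prodv f f' : (forall l g, f l g = f' l g) -> prodv f = prodv f'.
Proof. by move=> ff; apply/ffunP => g; rewrite !ffunE; apply: eq_bigr => l _. Qed.

Lemma prodv_eq0 f l : (forall g, f l g = 0) -> prodv f = 0.
Proof. by move=> f0; apply/ffunP => g; rewrite !ffunE (bigD1 l) //= f0 mul0r. Qed.

Lemma prodv_scale f l a h : (forall g, f l g = a * h g) ->
  prodv f = a *: prodv (fun l' => if l' == l then h else f l').
Proof.
move=> fl; apply/ffunP => g; rewrite !ffunE (bigD1 l) //= fl [in RHS](bigD1 l) //= eqxx.
rewrite /GRing.scale /= mulrA; congr (_ * _).
by apply: eq_bigr => l' /negPf ->.
Qed.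

Definition hwv : tensor := prodv (fun l => minor (k l) 1%:M).

Lemma tact_hwv_upper A : (forall i j : 'I_n.+1, (j < i)%N -> A i j = 0) ->
  tact A hwv = (\sum_l \sum_(j < n.+1 | (j <= k l)%N) A j j) *: hwv.
Proof.
move=> Aup; rewrite tact_prodv scaler_suml; apply: eq_bigr => l _.
rewrite (@prodv_scale _ l (\sum_(j < n.+1 | (j <= k l)%N) A j j) (minor (k l) 1%:M)) => [|g].
  by congr (_ *: _); apply: eq_prodv => l' g; case: eqVneq => [->|].
by rewrite eqxx bact_upper.
Qed.

(** Each factor absorbs x y at most once, and the factors outside T not at all, so more than |T|
    applications give zero. *)
Lemma iter_tact_rank1 (x : 'cV[F]_n.+1) (y : 'rV[F]_n.+1) (T : {set L}) N :
    y *m x = 0 -> (forall l g, l \notin T -> rank1_minor (k l) x y g = 0) ->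
  (#|T| < N)%N -> iter N (tact (x *m y)) hwv = 0.
Proof.
move=> yx T0 TN.
pose w (S : {set L}) := prodv (fun l => if l \in S then rank1_minor (k l) x y else minor (k l) 1%:M).
have wact S : tact (x *m y) (w S) = \sum_(l | l \notin S) w (l |: S).
  rewrite tact_prodv [RHS]big_mkcond; apply: eq_bigr => l _.
  have [lS|lS] := boolP (l \in S).
    by apply: (@prodv_eq0 _ l) => g; rewrite eqxx bact_rank1_rank1.
  apply: eq_prodv => l' g; rewrite !inE.
  by have [->|l'l] //= := eqVneq l' l; rewrite bact_rank1.
(* The list r records a coefficient and the set of factors already hit; each further application
   enlarges that set by one new factor. *)
have [r rN ->] : exists2 r : seq (F * {set L}),
    forall e, e \in r -> #|e.2| = N &
    iter N (tact (x *m y)) hwv = \sum_(e <- r) (e.1 : F) *: w e.2.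
  elim: (N) => [|N' [r rN IH]].
    exists [:: (1, finset.set0)] => [e|]; first by rewrite inE => /eqP ->; rewrite cards0.
    rewrite big_seq1 scale1r; apply: eq_prodv => l g; by rewrite inE.
  exists [seq (e.1, l |: e.2) | e <- r, l <- enum (~: e.2)].
    move=> _ /allpairsPdep[e [l [er le ->]]] /=.
    by move: le; rewrite mem_enum inE => le; rewrite cardsU1 le rN.
  rewrite iterS IH linear_sum big_allpairs_dep /=; apply: eq_bigr => e _.
  rewrite linearZ /= wact scaler_sumr big_enum /=.
  by apply: eq_bigl => l; rewrite inE.
rewrite big_seq big1 // => e er; have eN := rN _ er.
have [l le lT] : exists2 l, l \in e.2 & l \notin T.
  by apply/subsetPn; apply: contraTN TN => /subset_leq_card; rewrite eN -leqNgt.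
by rewrite [w _](@prodv_eq0 _ l) ?scaler0 // => g; rewrite le T0.
Qed.

End HighestWeightVector.

(** * Monomials in the root vectors acting on the tensor product *)

Section WordAction.
Variables (F : numClosedFieldType) (n : nat) (L : finType) (k : L -> 'I_n).
Local Notation position := (L * 'I_n.+1)%type.
Local Notation state := {ffun position -> 'I_n.+1}.
Local Notation tensor := {ffun state -> F^o}.
Local Notation tact := (@tact F n L k).
Local Notation active := (active k).
Implicit Types (b c : posroot n) (bs : seq (posroot n)) (u : tensor) (p : position).
Implicit Types (beta g : state).

Definition root_src b : 'I_n.+1 := widen_ord (leqnSn n) (root_fst b).
Definition root_tgt b : 'I_n.+1 := lift ord0 (root_snd b).

(* The root vector of -alpha_(p,q) is the matrix unit E_(q+1,p). *)
Definition root_mx b : 'M[F]_n.+1 := delta_mx (root_tgt b) (root_src b).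

Lemma root_tgtE b : root_tgt b = (root_snd b).+1 :> nat.
Proof. by []. Qed.

Lemma root_srcE b : root_src b = root_fst b :> nat.
Proof. by []. Qed.

Lemma root_src_tgt_eq b c : (root_src b == root_src c) && (root_tgt b == root_tgt c) = (b == c).
Proof.
apply/andP/eqP => [[/eqP/(congr1 val) /= f /eqP/(congr1 val) /= g]|->]; last by rewrite !eqxx.
by apply: posroot_eqP; apply: val_inj => //; move: g; rewrite /bump !leq0n !add1n => -[].
Qed.

Lemma root_src_lt_tgt b c : (root_src b == root_src c) -> (root_src b < root_tgt c)%N.
Proof.
by move=> /eqP ->; rewrite root_srcE root_tgtE ltnS root_fst_snd.
Qed.

Lemma root_of_lt (i j : 'I_n.+1) : (i < j)%N ->
  exists2 c, i = root_src c & j = root_tgt c.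
Proof.
move=> ij; have jn := ltn_ord j; have i1 : (i < n)%N by lia.
have j1 : (j.-1 < n)%N by lia.
have ij1 : (Ordinal i1 <= Ordinal j1)%N by rewrite /=; lia.
exists (exist _ (Ordinal i1, Ordinal j1) ij1 : posroot n); apply: val_inj => //=.
by rewrite /root_snd /= /bump add1n; lia.
Qed.

(** The positions moved by the root vector of c when a monomial leads from the basis tensor beta to
    g. *)
Definition jumps beta g c :=
  [set p : position | [&& active p, beta p == root_src c & g p == root_tgt c]].

Lemma in_jumps beta g c p : (p \in jumps beta g c) =
  [&& active p, beta p == root_src c & g p == root_tgt c].
Proof. by rewrite inE. Qed.

Definition reach beta g : bool :=
  [forall p, if active p then (beta p <= g p)%N else beta p == g p].

Definition jumps_by beta g bs : bool :=
  reach beta g && [forall c, #|jumps beta g c| == count_mem c bs].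

Lemma tact_root_mx b u g : tact (root_mx b) u g =
  \sum_(p | active p && (g p == root_tgt b)) u (upd g p (root_src b)).
Proof.
rewrite ffunE [RHS]big_mkcondr; apply: eq_bigr => p _.
rewrite (bigD1 (root_src b)) //= big1 ?addr0 => [|c /negPf cb].
  by rewrite mxE eqxx andbT; case: eqP; rewrite ?mul1r ?mul0r.
by rewrite mxE cb andbF mul0r.
Qed.

Lemma card_jumps_upd beta g p b c :
    active p -> g p = root_tgt b -> beta p = root_src b ->
  #|jumps beta g c| = ((b == c) + #|jumps beta (upd g p (root_src b)) c|)%N.
Proof.
move=> ap gp bp; rewrite (cardD1 p) [in RHS](cardD1 p). rewrite !in_jumps ap gp bp upd_same.
rewrite root_src_tgt_eq; congr (_ + _)%N.
have -> : (root_src b == root_src c) && (root_src b == root_tgt c) = false.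
  by apply/negP => /andP[/root_src_lt_tgt + /eqP E]; rewrite E ltnn.
rewrite add0n; apply: eq_card => q; rewrite !inE; case: eqVneq => //= qp.
by rewrite upd_other.
Qed.

(* The letters of a word are sorted by source, so a letter prepended to the word
   cannot act on a position that has been moved already. *)
Lemma jumps_by_cons b bs beta g p : all (fun c => root_fst b <= root_fst c)%N bs ->
  (active p && (g p == root_tgt b)) && jumps_by beta (upd g p (root_src b)) bs =
  (p \in jumps beta g b) && jumps_by beta g (b :: bs).
Proof.
move=> bbs; rewrite in_jumps; have [ap|] //= := boolP (active p).
have [gp|] := eqVneq (g p) (root_tgt b); rewrite ?andbF //= andbT.
have src_tgt : (root_src b <= root_tgt b)%N by apply: ltnW; apply: root_src_lt_tgt.
apply/idP/idP => [/andP[/forallP r /forallP cnt]|/andP[/eqP bp /andP[/forallP r /forallP cnt]]].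
  have bp : beta p = root_src b.
    have := r p; rewrite ap upd_same leq_eqVlt => /orP[/eqP/val_inj //|lt].
    have [c bc cb] := root_of_lt lt.
    have : c \in bs.
      rewrite -has_pred1 has_count -(eqP (cnt c)) card_gt0; apply/set0Pn; exists p.
      by rewrite in_jumps ap bc upd_same cb !eqxx.
    move=> /(allP bbs); rewrite leqNgt => /negP[].
    by rewrite -!root_srcE -bc.
  rewrite bp eqxx /=; apply/andP; split; [apply/forallP => q|apply/forallP => c].
    have [->|qp] := eqVneq q p; first by rewrite ap bp gp.
    by have := r q; rewrite upd_other.
  by rewrite (card_jumps_upd c ap gp bp) /= (eqP (cnt c)).
apply/andP; split; [apply/forallP => q|apply/forallP => c].
  have [->|qp] := eqVneq q p; first by rewrite ap bp upd_same.
  by have := r q; rewrite upd_other.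
by have := cnt c; rewrite (card_jumps_upd c ap gp bp) /= eqn_add2l.
Qed.

(** A monomial leads from beta to g exactly when its letters are the jumps from beta to g, and equal
    letters can be assigned to their positions in any order, whence the factorials. *)
Lemma foldr_root_mx bs u g : sorted (fun b c => root_fst b <= root_fst c)%N bs ->
  foldr (fun b => tact (root_mx b)) u bs g =
  (\prod_c (count_mem c bs)`!)%:R * \sum_(beta | jumps_by beta g bs) u beta.
Proof.
elim: bs g => [|b bs IH] g.
  move=> _; rewrite big1 // mul1r (big_pred1 g) // => beta; rewrite -[RHS]/(beta == g).
  apply/andP/eqP => [[/forallP r /forallP cnt]|->]; last first.
    split; [apply/forallP => p|apply/forallP => c]; first by rewrite leqnn eqxx if_same.
    apply/eqP/eq_card0 => p; rewrite in_jumps; apply/negP => /and3P[_ /eqP E].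
    move=> /eqP E'; have := root_src_lt_tgt (eqxx (root_src c)).
    by rewrite -E -E' ltnn.
  apply/ffunP => p; have := r p; case: ifP => [ap|_ /eqP //].
  rewrite leq_eqVlt => /orP[/eqP/val_inj //|/root_of_lt[c bc gc]].
  have := cnt c; rewrite -leqn0 leqNgt => /negP[].
  by rewrite card_gt0; apply/set0Pn; exists p; rewrite in_jumps ap bc gc !eqxx.
move=> sbs; have bbs : all (fun c => root_fst b <= root_fst c)%N bs.
  by apply: order_path_min sbs => x y z; exact: leq_trans.
rewrite [LHS]/= tact_root_mx.
rewrite (eq_bigr _ (fun p _ => IH (upd g p (root_src b)) (path_sorted sbs))).
rewrite -mulr_sumr.
have -> : (\prod_c (count_mem c (b :: bs))`! = \prod_c (count_mem c bs)`! * (count_mem b bs).+1)%N.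
  rewrite (bigD1 b) // [X in (X * _)%N](bigD1 b) //= eqxx add1n factS.
  rewrite (eq_bigr (fun c => (count_mem c bs)`!)%N); last first.
    by move=> c /negPf cb; rewrite eq_sym cb.
  by rewrite -mulnA mulnC.
rewrite natrM -mulrA; congr (_ * _).
rewrite (exchange_big_dep xpredT) //= mulr_sumr [RHS]big_mkcond.
apply: eq_bigr => beta _.
rewrite (eq_bigl _ _ (fun p => jumps_by_cons beta g p bbs)) sumr_const.
case: ifP => [jb|nj].
  rewrite -[u beta *+ _]mulr_natl; congr (_%:R * _).
  rewrite (eq_card (B := jumps beta g b)); last by move=> p; rewrite [LHS]unfold_in andbT.
  by have /andP[_ /forallP/(_ b)/eqP ->] := jb; rewrite /= eqxx.
by rewrite eq_card0 ?mulr0n // => p; rewrite [LHS]unfold_in andbF.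
Qed.

End WordAction.

(** * The coordinate that detects a given sum of antichains *)

Section EssentialCoordinate.
Variables (F : numClosedFieldType) (n : nat) (L : finType) (k : L -> 'I_n).
Local Notation position := (L * 'I_n.+1)%type.
Local Notation state := {ffun position -> 'I_n.+1}.
Local Notation active := (active k).
Local Notation hwv := (hwv F k).
Implicit Types (b c : posroot n) (bs : seq (posroot n)) (p : position).
Implicit Types (beta g : state).

Definition id_state : state := [ffun p => p.2].

Definition root_lex_weight (t : posroot n -> nat) : nat :=
  (\sum_c t c * lex_weight n (root_src c) (root_tgt c))%N.

(** An active position either stays, with weight 0, or jumps along exactly one root; so a sum over
    roots becomes a sum over positions. *)
Lemma root_lex_weight_jumps beta g : reach k beta g ->
  root_lex_weight (fun c => #|jumps k beta g c|) =
  (\sum_l \sum_(i < n.+1 | i <= k l) lex_weight n (beta (l, i)) (g (l, i)))%N.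
Proof.
move=> /forallP r; rewrite pair_big_dep /=.
transitivity (\sum_c \sum_(p | active p)
   (p \in jumps k beta g c) * lex_weight n (root_src c) (root_tgt c))%N.
  apply: eq_bigr => c _; rewrite -big_distrl /= -big_mkcondr; congr (_ * _)%N.
  rewrite sum1_card; apply: eq_card => p; rewrite !inE.
  by rewrite [RHS]unfold_in /= in_jumps; case: (active p).
rewrite exchange_big; apply: eq_big => [[l i]|[l i] ap] //=.
have := r (l, i); rewrite ap leq_eqVlt => /orP[/eqP E|lt].
  rewrite {2}/lex_weight E ltnn big1 // => c _.
  rewrite in_jumps; case: eqP => [bc|]; rewrite ?andbF //=.
  case: eqP => [gc|]; rewrite ?andbF //=.
  by have := root_src_lt_tgt (eqxx (root_src c)); rewrite -bc -gc E ltnn.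
have [c bc gc] := root_of_lt lt.
rewrite (bigD1 c) //= in_jumps ap bc gc !eqxx mul1n.
rewrite big1 ?addn0 // => d dc; rewrite in_jumps bc gc root_src_tgt_eq.
by rewrite eq_sym (negPf dc) andbF.
Qed.

Lemma hwv_id_state : hwv id_state = 1.
Proof.
rewrite ffunE big1 // => l _; rewrite /minor (_ : minor_mx _ _ _ = 1%:M) ?det1 //.
by apply/matrixP => i j; rewrite !mxE !ffunE if_same.
Qed.

Lemma hwv_perm beta l : hwv beta != 0 ->
  exists2 sg : {perm 'I_n.+1}, forall i : 'I_n.+1, (i <= k l)%N -> sg i = beta (l, i)
    & forall i : 'I_n.+1, (k l < i)%N -> sg i = i.
Proof.
rewrite ffunE prodf_seq_neq0 => /allP /(_ l (mem_index_enum _)) /= det_neq0.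
pose f (i : 'I_n.+1) := if (i <= k l)%N then beta (l, i) else i.
have f_inj : injective f.
  move=> i j fij; apply: contraNeq det_neq0 => ij; apply/eqP.
  rewrite /minor (determinant_alternate ij) // => c.
  have E a : minor_mx (k l) 1%:M (slice beta l) a c = (f a == c)%:R :> F.
    by rewrite !mxE /f; case: leqP => // _; rewrite ffunE.
  by rewrite !E fij.
exists (perm f_inj) => i; rewrite permE /f; first by move=> ->.
by rewrite ltnNge => /negPf ->.
Qed.

Variable M : L -> {set posroot n}.
Hypothesis antiM : forall l, fund_antichain (k l) (M l).

(* The basis tensor reached from the identity state by the antichain monomial. *)
Definition antichain_state : state := [ffun p =>
  if [pick c in M p.1 | root_src c == p.2] is Some c then root_tgt c else p.2].

Lemma antichain_stateP p :
  (exists c, [/\ c \in M p.1, root_src c = p.2 & antichain_state p = root_tgt c]) \/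
  (antichain_state p = p.2 /\ forall c, c \in M p.1 -> root_src c != p.2).
Proof.
rewrite ffunE; case: pickP => [c /andP[cM /eqP cp]|nc]; [left|right].
  by exists c.
by split=> // c cM; have := nc c; rewrite cM => /negbT.
Qed.

Lemma antichain_state_root l c : c \in M l -> antichain_state (l, root_src c) = root_tgt c.
Proof.
move=> cM; have [[d [/= dM ds ->]]|[_ /(_ c cM)]] := antichain_stateP (l, root_src c).
  congr root_tgt; have [_ anti] := antiM l.
  have E : root_fst d = root_fst c by apply: val_inj; move/(congr1 val): ds.
  have : root_le d c || root_le c d by rewrite /root_le E leqnn /= leq_total.
  by move=> /orP[/(anti _ _ dM cM)|/(anti _ _ cM dM)].
by rewrite eqxx.
Qed.

Lemma antichain_root_active l c : c \in M l -> active (l, root_src c).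
Proof. by move=> cM; have [/(_ c cM) /andP[]] := antiM l. Qed.

Lemma reach_id_antichain : reach k id_state antichain_state.
Proof.
apply/forallP => p; rewrite [id_state p]ffunE.
have [[c [cM cp ->]]|[-> _]] := antichain_stateP p; last by rewrite leqnn eqxx if_same.
have := antichain_root_active cM; rewrite cp -surjective_pairing => ->.
by rewrite -cp ltnW // root_src_lt_tgt.
Qed.

Definition antichain_exp c : nat := (\sum_l (c \in M l))%N.

Lemma jumps_id_antichain c : #|jumps k id_state antichain_state c| = antichain_exp c.
Proof.
rewrite /antichain_exp -big_mkcond sum1_card /=.
rewrite -(card_imset (mem (fun l => c \in M l)) (f := fun l => (l, root_src c))); last by move=> l l' [].
apply: eq_card => p; rewrite in_jumps; apply/idP/imsetP => [/and3P[ap /eqP]|[l lM ->]].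
  rewrite ffunE => pc /eqP gc; exists p.1; last by rewrite -pc -surjective_pairing.
  have [[d [dM ds dt]]|[E _]] := antichain_stateP p.
    suff /eqP <- : d == c by [].
    by rewrite -root_src_tgt_eq ds pc -dt gc !eqxx.
  by have := root_src_lt_tgt (eqxx (root_src c)); rewrite -gc E pc ltnn.
by rewrite antichain_root_active // ffunE antichain_state_root // !eqxx.
Qed.

Lemma antichain_state_le p : active p -> antichain_state p = p.2 \/ (k p.1 < antichain_state p)%N.
Proof.
move=> ap; have [[c [cM _ ->]]|[-> _]] := antichain_stateP p; last by left.
by right; rewrite root_tgtE ltnS; have [/(_ c cM) /andP[]] := antiM p.1.
Qed.

(** Incomparable roots are nested: the one with the larger source has the smaller target. *)
Lemma antichain_state_dec l (i j : 'I_n.+1) : (i < j)%N -> (j <= k l)%N ->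
  (k l < antichain_state (l, i))%N -> (k l < antichain_state (l, j))%N ->
  (antichain_state (l, j) < antichain_state (l, i))%N.
Proof.
move=> ij jk; have ik : (i <= k l)%N by exact: leq_trans (ltnW ij) jk.
have [[c [/= cM ci ->]] _|[-> _]] := antichain_stateP (l, i); last by rewrite ltnNge ik.
have [[d [/= dM dj ->]] _|[-> _]] := antichain_stateP (l, j); last by rewrite ltnNge jk.
rewrite ltnNge; apply/negP => cd; have [_ anti] := antiM l.
have cd' : root_le c d.
  move/(congr1 val): ci; move/(congr1 val): dj; rewrite /root_le /= => -> ->.
  by rewrite (ltnW ij).
by move: ij; rewrite -ci -dj (anti _ _ cM dM cd') ltnn.
Qed.

(** In each factor beta permutes the indices 0, .., k l, so [nested_perm_max] applies factor by
    factor, and the weights add up. *)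
Lemma hwv_reach_antichain beta : hwv beta != 0 -> reach k beta antichain_state ->
  beta = id_state \/
  (root_lex_weight (fun c => #|jumps k beta antichain_state c|) < root_lex_weight antichain_exp)%N.
Proof.
move=> /hwv_perm nz r; have /forallP r' := r.
have -> : root_lex_weight antichain_exp =
   root_lex_weight (fun c => #|jumps k id_state antichain_state c|).
  by apply: eq_bigr => c _; rewrite jumps_id_antichain.
rewrite !root_lex_weight_jumps ?reach_id_antichain //.
have dich l : (forall i : 'I_n.+1, (i <= k l)%N -> beta (l, i) = i) \/
   (\sum_(i < n.+1 | i <= k l) lex_weight n (beta (l, i)) (antichain_state (l, i)) <
    \sum_(i < n.+1 | i <= k l) lex_weight n (id_state (l, i)) (antichain_state (l, i)))%N.
  have [sg sgle sgt] := nz l.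
  pose gam i := antichain_state (l, i).
  have gle (i : 'I_n.+1) : (i <= k l)%N -> gam i = i \/ (k l < gam i)%N.
    by move=> ik; exact: (@antichain_state_le (l, i)).
  have sgam (i : 'I_n.+1) : (i <= k l)%N -> (sg i <= gam i)%N.
    by move=> ik; rewrite sgle //; have := r' (l, i); rewrite /active ik.
  have [sg1|lt] := nested_perm_max gle (@antichain_state_dec l) sgt sgam.
    by left=> i ik; rewrite -sgle // sg1 perm1.
  right; rewrite (eq_bigr (fun i => lex_weight n (sg i) (antichain_state (l, i)))).
    by rewrite [X in (_ < X)%N](eq_bigr (fun i : 'I_n.+1 => lex_weight n i (antichain_state (l, i)))) // => i _; rewrite [id_state _]ffunE.
  by move=> i ik; rewrite sgle.
have [/existsP[l lt]|] := boolP [exists l,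
   (\sum_(i < n.+1 | i <= k l) lex_weight n (beta (l, i)) (antichain_state (l, i)) <
    \sum_(i < n.+1 | i <= k l) lex_weight n (id_state (l, i)) (antichain_state (l, i)))%N].
  right; rewrite (bigD1 l) //= [X in (_ < X)%N](bigD1 l) //= -addSn leq_add //.
  apply: leq_sum => l' _; have [E|/ltnW //] := dich l'.
  by rewrite leq_eqVlt; apply/orP; left; apply/eqP; apply: eq_bigr => i ik; rewrite E // [id_state _]ffunE.
rewrite negb_exists => /forallP nlt; left; apply/ffunP => -[l i]; rewrite ffunE /=.
have := r' (l, i); rewrite /active /=; case: leqP => [ik _|ki /eqP ->].
  by have [->//|lt] := dich l; have := nlt l; rewrite lt.
have [[c [/= cM ci _]]|[-> //]] := antichain_stateP (l, i).
by have := antichain_root_active cM; rewrite ci /active /= leqNgt ki.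
Qed.

Local Notation word bs := (foldr (fun b => tact k (root_mx F b)) hwv bs).

Lemma word_antichain_state bs : sorted (fun b c => root_fst b <= root_fst c)%N bs ->
    word bs antichain_state != 0 ->
  (forall c, count_mem c bs = antichain_exp c) \/
  (root_lex_weight (fun c => count_mem c bs) < root_lex_weight antichain_exp)%N.
Proof.
move=> sbs; rewrite foldr_root_mx // mulf_eq0 negb_or => /andP[_].
move=> /eqP nz; have [beta jb wb] : exists2 beta, jumps_by k beta antichain_state bs & hwv beta != 0.
  apply: contrapT => nex; apply: nz; rewrite big1 // => beta jb.
  by apply/eqP/negPn/negP => wb; apply: nex; exists beta.
have /andP[r /forallP cnt] := jb.
have [E|lt] := hwv_reach_antichain wb r.
  by left=> c; rewrite -(eqP (cnt c)) E jumps_id_antichain.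
right; apply: leq_trans lt; rewrite ltnS leq_eqVlt; apply/orP; left; apply/eqP.
by apply: eq_bigr => c _; rewrite (eqP (cnt c)).
Qed.

(** Only [id_state] contributes: any other beta would have jumps of strictly smaller weight, while
    here the jumps have the exponents of the antichains. There is no cancellation. *)
Lemma word_antichain_state_neq0 bs : sorted (fun b c => root_fst b <= root_fst c)%N bs ->
  (forall c, count_mem c bs = antichain_exp c) -> word bs antichain_state != 0.
Proof.
move=> sbs cntE; rewrite foldr_root_mx // mulf_neq0 //.
  by rewrite pnatr_eq0 -lt0n prodn_gt0 // => c; rewrite fact_gt0.
rewrite (bigD1 id_state) /=; last first.
  rewrite /jumps_by reach_id_antichain; apply/forallP => c.
  by rewrite jumps_id_antichain cntE.
rewrite hwv_id_state big1 ?addr0 ?oner_eq0 // => beta /andP[/andP[r /forallP cnt] nid].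
apply/eqP/negPn/negP => /hwv_reach_antichain /(_ r) [/eqP|]; first by rewrite (negPf nid).
rewrite ltnNge => /negP[]; rewrite leq_eqVlt; apply/orP; left; apply/eqP.
by apply: eq_bigr => c _; rewrite (eqP (cnt c)) cntE.
Qed.

End EssentialCoordinate.

(** * Highest weight modules and the PBW filtration *)

Section Span.
Variables (F : fieldType) (U : lmodType F).
Implicit Types (P Q : U -> Prop) (u v : U).

(** Defined over any [lmodType], so that it serves V, the tensor product and their direct sum alike;
    membership is used by induction. *)
Inductive lin_span P : U -> Prop :=
| lin_span0 : lin_span P 0
| lin_span_cons a u v : P u -> lin_span P v -> lin_span P (a *: u + v).

Lemma lin_span_mem P u : P u -> lin_span P u.
Proof. by move=> Pu; rewrite -[u]addr0 -[u]scale1r; apply: lin_span_cons => //; exact: lin_span0. Qed.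

Lemma lin_span_lin P a u v : lin_span P u -> lin_span P v -> lin_span P (a *: u + v).
Proof.
move=> Su Sv; elim: Su => [|b w u' Pw _ IH]; first by rewrite scaler0 add0r.
by rewrite scalerDr -addrA scalerA; apply: lin_span_cons.
Qed.

Lemma lin_span_add P u v : lin_span P u -> lin_span P v -> lin_span P (u + v).
Proof. by move=> Su Sv; rewrite -[u]scale1r; exact: lin_span_lin. Qed.

Lemma lin_span_scale P a u : lin_span P u -> lin_span P (a *: u).
Proof. by move=> Su; rewrite -[_ *: _]addr0; apply: lin_span_lin => //; exact: lin_span0. Qed.

Lemma lin_span_opp P u : lin_span P u -> lin_span P (- u).
Proof. by rewrite -scaleN1r; exact: lin_span_scale. Qed.

Lemma lin_span_sub P u v : lin_span P u -> lin_span P v -> lin_span P (u - v).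
Proof. by move=> Su Sv; apply: lin_span_add => //; exact: lin_span_opp. Qed.

Lemma lin_span_sum P (I : Type) (r : seq I) (p : pred I) (f : I -> U) :
  (forall i, p i -> lin_span P (f i)) -> lin_span P (\sum_(i <- r | p i) f i).
Proof. by move=> Pf; elim/big_ind: _ => //; [exact: lin_span0|exact: lin_span_add]. Qed.

Lemma lin_span_sub_span P Q u : (forall v, P v -> lin_span Q v) -> lin_span P u -> lin_span Q u.
Proof.
by move=> PQ; elim=> [|a w u' /PQ Qw _ Qu']; [exact: lin_span0|exact: lin_span_lin].
Qed.

End Span.

Lemma lin_span_linear (F : fieldType) (U V : lmodType F) (P : U -> Prop) (Q : V -> Prop)
    (f : U -> V) u : (forall a u v, f (a *: u + v) = a *: f u + f v) ->
  (forall v, P v -> lin_span Q (f v)) -> lin_span P u -> lin_span Q (f u).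
Proof.
move=> flin PQ; elim=> [|a w u' /PQ Qw _ Qu'].
  have := flin (-1) 0 0; by rewrite scaler0 addr0 scaleN1r addNr => ->; exact: lin_span0.
by rewrite flin; exact: lin_span_lin.
Qed.

Section HighestWeightModule.
Variables (F : numClosedFieldType) (n : nat) (U : lmodType F).
Variable act : 'M[F]_n.+1 -> U -> U.
Implicit Types (A B : 'M[F]_n.+1) (u v : U) (b c : posroot n) (bs : seq (posroot n)).

Definition is_gl_action : Prop :=
  [/\ forall A a u v, act A (a *: u + v) = a *: act A u + act A v,
      forall a A B u, act (a *: A + B) u = a *: act A u + act B u &
      forall A B u, act (A *m B - B *m A) u = act A (act B u) - act B (act A u)].

Definition is_upper A : Prop := forall i j : 'I_n.+1, (j < i)%N -> A i j = 0.
Definition is_lower A : Prop := forall i j : 'I_n.+1, (i <= j)%N -> A i j = 0.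

Definition upper_part A : 'M[F]_n.+1 := \matrix_(i, j) if (i <= j)%N then A i j else 0.
Definition lower_part A : 'M[F]_n.+1 := \matrix_(i, j) if (i <= j)%N then 0 else A i j.

Lemma upper_lower_part A : A = upper_part A + lower_part A.
Proof. by apply/matrixP => i j; rewrite !mxE; case: ifP; rewrite ?addr0 ?add0r. Qed.

Lemma upper_part_upper A : is_upper (upper_part A).
Proof. by move=> i j ji; rewrite mxE leqNgt ji. Qed.

Lemma lower_part_lower A : is_lower (lower_part A).
Proof. by move=> i j ij; rewrite mxE ij. Qed.

Lemma lower_decomposition A : is_lower A ->
  A = \sum_b A (root_tgt b) (root_src b) *: root_mx F b.
Proof.
move=> Al; apply/matrixP => i j; rewrite summxE.
have [ij|ji] := leqP i j.
  rewrite Al // big1 // => b _; rewrite !mxE; have [ib|_] := eqVneq i (root_tgt b); last by rewrite mulr0.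
  have [jb|_] := eqVneq j (root_src b); last by rewrite mulr0.
  by have := root_src_lt_tgt (eqxx (root_src b)); rewrite -ib -jb ltnNge ij.
have [b -> ->] := root_of_lt ji.
rewrite (bigD1 b) //= !mxE !eqxx mulr1 big1 ?addr0 // => c cb.
by rewrite !mxE andbC root_src_tgt_eq eq_sym (negPf cb) mulr0.
Qed.

Hypothesis actP : is_gl_action.

Lemma act_linr A a u v : act A (a *: u + v) = a *: act A u + act A v.
Proof. by case: actP. Qed.

Lemma act_linl a A B u : act (a *: A + B) u = a *: act A u + act B u.
Proof. by case: actP. Qed.

Lemma act_comm A B u : act A (act B u) = act B (act A u) + act (A *m B - B *m A) u.
Proof. by case: actP => _ _ ->; rewrite addrC subrK. Qed.

Lemma act0r A : act A 0 = 0.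
Proof. by have := act_linr A (-1) 0 0; rewrite !(scaler0, addr0) scaleN1r addNr. Qed.

Lemma act0l u : act 0 u = 0.
Proof. by have := act_linl (-1) 0 0 u; rewrite !(scaler0, addr0) scaleN1r addNr. Qed.

Lemma actZr A a u : act A (a *: u) = a *: act A u.
Proof. by rewrite -[a *: u]addr0 act_linr act0r addr0. Qed.

Lemma actZl A a u : act (a *: A) u = a *: act A u.
Proof. by rewrite -[a *: A]addr0 act_linl act0l addr0. Qed.

Lemma actDr A u v : act A (u + v) = act A u + act A v.
Proof. by rewrite -[u in LHS]scale1r act_linr scale1r. Qed.

Lemma actDl A B u : act (A + B) u = act A u + act B u.
Proof. by rewrite -[A in LHS]scale1r act_linl scale1r. Qed.

Lemma actBr A u v : act A (u - v) = act A u - act A v.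
Proof. by rewrite actDr -scaleN1r actZr scaleN1r. Qed.

Lemma act_sumr A (I : Type) (r : seq I) (p : pred I) (f : I -> U) :
  act A (\sum_(i <- r | p i) f i) = \sum_(i <- r | p i) act A (f i).
Proof. by apply: (big_morph _ (actDr A) (act0r A)). Qed.

Lemma act_suml u (I : Type) (r : seq I) (p : pred I) (f : I -> 'M[F]_n.+1) :
  act (\sum_(i <- r | p i) f i) u = \sum_(i <- r | p i) act (f i) u.
Proof. by apply: (big_morph (act^~ u) (fun A B => actDl A B u) (act0l u)). Qed.

Definition root_word bs u : U := foldr (fun b => act (root_mx F b)) u bs.

Lemma root_word_cat bs bs' u : root_word (bs ++ bs') u = root_word bs (root_word bs' u).
Proof. by rewrite /root_word foldr_cat. Qed.

Lemma root_word_lin bs a u v :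
  root_word bs (a *: u + v) = a *: root_word bs u + root_word bs v.
Proof. by elim: bs => //= b bs ->; rewrite act_linr. Qed.

Variables (u0 : U) (chi : 'M[F]_n.+1 -> F).
Hypothesis u0_hw : forall A, is_upper A -> act A u0 = chi A *: u0.

Definition pbw (d : nat) : U -> Prop :=
  lin_span (fun u => exists2 bs, (size bs <= d)%N & u = root_word bs u0).

Lemma pbw_word bs d : (size bs <= d)%N -> pbw d (root_word bs u0).
Proof. by move=> bd; apply: lin_span_mem; exists bs. Qed.

Lemma pbw_mono d d' u : (d <= d')%N -> pbw d u -> pbw d' u.
Proof.
move=> dd; apply: lin_span_sub_span => v [bs bd ->]; apply: pbw_word.
exact: leq_trans dd.
Qed.

Lemma pbw_root_word bs d u : pbw d u -> pbw (size bs + d) (root_word bs u).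
Proof.
apply: lin_span_linear => [a w w'|v [bs' bd ->]]; first exact: root_word_lin.
by rewrite -root_word_cat; apply: pbw_word; rewrite size_cat leq_add2l.
Qed.

Lemma pbw_lower A d u : is_lower A -> pbw d u -> pbw d.+1 (act A u).
Proof.
move=> Al du; rewrite {1}(lower_decomposition Al) act_suml; apply: lin_span_sum => b _.
by rewrite actZl; apply: lin_span_scale; exact: (@pbw_root_word [:: b]).
Qed.

(** Moving A past a letter creates a commutator: its upper part acts on a shorter word, by
    induction, and its lower part merely takes the place of the lost letter. *)
Lemma pbw_upper A d u : is_upper A -> pbw d u -> pbw d (act A u).
Proof.
move=> Aup; apply: lin_span_linear => [a w w'|v [bs bd ->]]; first exact: act_linr.
apply: pbw_mono bd _; elim: bs A Aup => [|b bs IH] A Aup /=.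
  by rewrite u0_hw //; apply: lin_span_scale; exact: (@pbw_word [::]).
rewrite act_comm; apply: lin_span_add; first exact/(@pbw_root_word [:: b])/IH.
rewrite [X in act X _]upper_lower_part actDl; apply: lin_span_add.
  by apply: (@pbw_mono (size bs)) => //; apply: IH; exact: upper_part_upper.
by apply: pbw_lower; [exact: lower_part_lower|exact: pbw_word].
Qed.

Lemma pbw_act A d u : pbw d u -> pbw d.+1 (act A u).
Proof.
move=> du; rewrite [A]upper_lower_part actDl; apply: lin_span_add.
  by apply: (@pbw_mono d) => //; apply: pbw_upper => //; exact: upper_part_upper.
by apply: pbw_lower => //; exact: lower_part_lower.
Qed.

Lemma root_mx_lower b : is_lower (root_mx F b).
Proof.
move=> i j ij; rewrite mxE; case: eqP => [ib|] //=; case: eqP => [jb|] //=.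
by have := root_src_lt_tgt (eqxx (root_src b)); rewrite -ib -jb ltnNge ij.
Qed.

Lemma is_lower_comm A B : is_lower A -> is_lower B -> is_lower (A *m B - B *m A).
Proof.
suff H A' B' : is_lower A' -> is_lower B' -> is_lower (A' *m B').
  by move=> Al Bl i j ij; rewrite mxE (H A B) // mxE (H B A) // subrr.
move=> Al Bl i j ij; rewrite mxE big1 // => k _.
have [ik|ki] := leqP i k; first by rewrite Al // mul0r.
by rewrite Bl ?mulr0 // (leq_trans (ltnW ki)).
Qed.

Lemma root_word_move b bs bs' :
  pbw (size bs + size bs') (root_word (bs ++ b :: bs') u0 - root_word (b :: bs ++ bs') u0).
Proof.
elim: bs => [|c bs IH] /=; first by rewrite subrr; exact: lin_span0.
rewrite [X in _ - X]act_comm opprD addrA -actBr; apply: lin_span_sub.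
  exact: (@pbw_root_word [:: c]).
apply: pbw_lower; first by apply: is_lower_comm; exact: root_mx_lower.
by apply: pbw_word; rewrite size_cat.
Qed.

(** The associated graded module is one over a commutative algebra: commutators of two letters are
    single elements of n^-, hence cost one degree. *)
Lemma root_word_perm d bs bs' : perm_eq bs bs' -> (size bs <= d.+1)%N ->
  pbw d (root_word bs u0 - root_word bs' u0).
Proof.
elim: bs bs' d => [|b bs IH] bs' d.
  by rewrite perm_sym => /perm_nilP -> _; rewrite subrr; exact: lin_span0.
move=> pe; have bbs' : b \in bs' by rewrite -(perm_mem pe) mem_head.
move: bbs' pe => /path.splitPr[a a']; rewrite perm_sym (perm_catCA a [:: b] a') /= perm_cons perm_sym => pe.
rewrite ltnS => bsd; rewrite -[X in pbw _ (X - _)](subrK (root_word (b :: a ++ a') u0)).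
rewrite -addrA; apply: lin_span_add; last first.
  rewrite -opprB; apply: lin_span_opp; apply: (pbw_mono _ (root_word_move b a a')).
  by rewrite -size_cat -(perm_size pe).
(* For d = 0 the word has a single letter; otherwise the induction hypothesis at d - 1 is multiplied
   by b. *)
case: d bsd => [|d] bsd.
  move: bsd pe; rewrite leqn0 size_eq0 => /eqP ->; rewrite perm_sym => /perm_nilP ->.
  by rewrite subrr; exact: lin_span0.
by rewrite /= -actBr; apply: (@pbw_root_word [:: b]); exact: IH.
Qed.

(** A grading element: each root vector f_b raises its eigenvalue by the height of the root, so it
    separates u0 from all nonempty words. *)
Definition height_mx : 'M[F]_n.+1 := \matrix_(i, j) ((i == j)%:R * i%:R).

Lemma height_mx_upper : is_upper height_mx.
Proof. by move=> i j ji; rewrite mxE -val_eqE /= gtn_eqF // mul0r. Qed.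

Lemma height_root_mx b : height_mx *m root_mx F b - root_mx F b *m height_mx =
  (root_tgt b - root_src b)%:R *: root_mx F b.
Proof.
apply/matrixP => i j; rewrite !mxE (bigD1 i) //= big1 => [|c /negPf ci]; last first.
  by rewrite !mxE eq_sym ci mul0r mul0r.
rewrite [X in _ - X](bigD1 j) //= [X in _ - (_ + X)]big1 => [|c /negPf cj]; last first.
  by rewrite !mxE cj mul0r mulr0.
rewrite !mxE !eqxx !addr0 !mul1r natrB; last by rewrite ltnW // root_src_lt_tgt.
by have [->|_] := eqVneq i (root_tgt b); have [->|_] := eqVneq j (root_src b); rewrite /=; ring.
Qed.

Local Notation chi0 := (chi height_mx).

Lemma act_height_word bs : exists2 d : nat, (0 < size bs)%N -> (0 < d)%N &
  act height_mx (root_word bs u0) = (chi0 + d%:R) *: root_word bs u0.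
Proof.
elim: bs => [|b bs [d _ IH]] /=.
  by exists 0%N => //; rewrite u0_hw ?addr0 //; exact: height_mx_upper.
exists (d + (root_tgt b - root_src b))%N.
  by move=> _; rewrite addn_gt0 subn_gt0 root_src_lt_tgt ?orbT.
by rewrite act_comm IH actZr height_root_mx actZl -scalerDl natrD addrA.
Qed.

(* height_killer D kills the components of height 1, .., D over the highest
   weight vector, and multiplies the latter by a nonzero scalar. *)
Fixpoint height_killer (D : nat) u : U :=
  if D is D'.+1 then
    act height_mx (height_killer D' u) - (chi0 + D%:R) *: height_killer D' u
  else u.

Definition killer_scalar (d D : nat) : F := \prod_(i < D) (d%:R - i.+1%:R).

Lemma height_killer_lin D a u v :
  height_killer D (a *: u + v) = a *: height_killer D u + height_killer D v.
Proof.
elim: D => //= D ->; rewrite act_linr !scalerDr !scalerN !scalerA [_ * a]mulrC.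
by rewrite opprD addrACA.
Qed.

Lemma height_killer_eigen (d D : nat) u : act height_mx u = (chi0 + d%:R) *: u ->
  height_killer D u = killer_scalar d D *: u.
Proof.
move=> hu; elim: D => [|D IH] /=; first by rewrite /killer_scalar big_ord0 scale1r.
rewrite IH actZr hu !scalerA -scalerBl /killer_scalar big_ord_recr /=.
by congr (_ *: _); ring.
Qed.

Lemma killer_scalar0_neq0 D : killer_scalar 0 D != 0.
Proof. by apply/prodf_neq0 => i _; rewrite sub0r oppr_eq0 pnatr_eq0. Qed.

Lemma height_killer_hw D : height_killer D u0 = killer_scalar 0 D *: u0.
Proof. by apply: height_killer_eigen; rewrite u0_hw ?addr0 //; exact: height_mx_upper. Qed.

(** The scalar c collects the coefficients of the empty word. A nonempty word has some height e > 0
    and vanishes once D >= e. All large D are allowed so that summands can share a common D. *)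
Lemma height_killer_pbw d u : pbw d u -> exists (c : F) (D0 : nat),
  forall D, (D0 <= D)%N -> height_killer D u = (c * killer_scalar 0 D) *: u0.
Proof.
elim=> [|a w u' [bs _ ->] _ [c [D0 H]]].
  exists 0, 0%N => D _; rewrite mul0r scale0r.
  by elim: D => //= D ->; rewrite act0r scaler0 subr0.
have [c' [D1 H1]] : exists (c : F) (D0 : nat), forall D, (D0 <= D)%N ->
    height_killer D (root_word bs u0) = (c * killer_scalar 0 D) *: u0.
  case: bs => [|b bs].
    by exists 1, 0%N => D _; rewrite mul1r height_killer_hw.
  have [e /(_ isT) e0 he] := act_height_word (b :: bs).
  exists 0, e => D eD; rewrite mul0r scale0r (height_killer_eigen _ he).
  rewrite /killer_scalar; have eD' : (e.-1 < D)%N by rewrite prednK.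
  by rewrite (bigD1 (Ordinal eD')) //= prednK // subrr mul0r scale0r.
exists (a * c' + c), (maxn D0 D1) => D; rewrite geq_max => /andP[D0D D1D].
by rewrite height_killer_lin H // H1 // scalerA -scalerDl mulrDl mulrA.
Qed.

End HighestWeightModule.

(** * The given module as a module over gl_(n+1) *)

Section TracelessPart.
Variables (F : numClosedFieldType) (n : nat).
Implicit Types A B : 'M[F]_n.+1.

(* Composing an action of sl_(n+1) with A |-> A - tr(A)/(n+1) extends it to gl_(n+1). *)
Definition traceless A : 'M[F]_n.+1 := A - (\tr A / n.+1%:R)%:M.

Lemma traceless_lin a A B : traceless (a *: A + B) = a *: traceless A + traceless B.
Proof.
rewrite /traceless mxtraceD mxtraceZ; apply/matrixP => i j; rewrite !mxE.
by case: (i == j); rewrite /= ?mulr1n ?mulr0n; ring.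
Qed.

Lemma mxtrace_traceless A : \tr (traceless A) = 0.
Proof.
rewrite /traceless raddfB /= mxtrace_scalar -[_ *+ n.+1]mulr_natr mulfVK ?subrr //.
by rewrite pnatr_eq0.
Qed.

Lemma traceless_id A : \tr A = 0 -> traceless A = A.
Proof. by rewrite /traceless => ->; rewrite mul0r raddf0 subr0. Qed.

Lemma traceless_bracket A B : traceless (A *m B - B *m A) =
  traceless A *m traceless B - traceless B *m traceless A.
Proof.
rewrite traceless_id; last by rewrite raddfB /= mxtrace_mulC subrr.
rewrite /traceless; set a := _ / _; set b := _ / _.
rewrite !mulmxBl !mulmxBr !mul_scalar_mx !mul_mx_scalar.
by apply/matrixP => i j; rewrite !mxE; case: (i == j); rewrite /= ?mulr1n ?mulr0n; ring.
Qed.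

Lemma traceless_upper A : is_upper A -> is_upper (traceless A).
Proof.
by move=> Aup i j ji; rewrite !mxE Aup // -val_eqE /= gtn_eqF // mulr0n subr0.
Qed.

Lemma traceless_root_mx b : traceless (root_mx F b) = root_mx F b :> 'M[F]_n.+1.
Proof.
apply: traceless_id; rewrite /mxtrace big1 // => i _; rewrite mxE.
case: eqP => //= ib; case: eqP => //= ib'.
by have := root_src_lt_tgt (eqxx (root_src b)); rewrite -ib -ib' ltnn.
Qed.

Lemma vsproj_traceless A : vsval (vsproj (sl F n) (traceless A)) = traceless A.
Proof. by rewrite vsprojK // mem_sl mxtrace_traceless. Qed.

End TracelessPart.

Section GlAction.
Variables (F : numClosedFieldType) (n : nat) (V : vectType F).
Variables (rho : {linear slT F n -> 'End(V)}) (v : V) (m : {ffun 'I_n -> nat}).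
Hypothesis rhoV : irreducible_highest_weight rho (dominant_weight m) v.
Implicit Types (A B : 'M[F]_n.+1) (u : V).

Definition gl_act A u : V := rho (vsproj (sl F n) (traceless A)) u.

Lemma gl_act_sl (x : slT F n) u : gl_act (vsval x) u = rho x u.
Proof.
rewrite /gl_act traceless_id; first by rewrite vsvalK.
by apply/eqP; rewrite -mem_sl subvsP.
Qed.

Lemma gl_act_action : is_gl_action gl_act.
Proof.
have [rep _ _] := rhoV; split=> [A a u u'|a A B u|A B u].
- exact: linearP.
- by rewrite /gl_act traceless_lin linearP linearP /= add_lfunE scale_lfunE.
- rewrite /gl_act traceless_bracket.
  have := congr1 (fun f : 'End(V) => f u) (rep (vsproj _ (traceless A)) (vsproj _ (traceless B))).
  by rewrite /lie_bracket !vsproj_traceless add_lfunE opp_lfunE !comp_lfunE.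
Qed.

Definition hw_char A : F :=
  \sum_(i < n) (m i)%:R * \sum_(j < n.+1 | (j <= i)%N) traceless A j j.

Lemma gl_act_hw A : is_upper A -> gl_act A v = hw_char A *: v.
Proof.
move=> Aup; have [_ _ [_ vplus vh]] := rhoV.
(* D is the diagonal of the traceless part, on which the weight is evaluated; the remainder is
   strictly upper triangular and kills v. *)
pose D : 'M[F]_n.+1 := \matrix_(i, j) if i == j then traceless A i j else 0.
have trD : \tr D = 0.
  rewrite -[RHS](mxtrace_traceless A); apply: eq_bigr => i _; by rewrite mxE eqxx.
rewrite /gl_act -[vsproj _ (traceless A)](subrK (vsproj _ D)) linearD add_lfunE.
rewrite vplus ?add0r => [|i j ji].
  rewrite vh.
    rewrite /weight_form /hw_char; congr (_ *: _); apply: eq_bigr => i _.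
    rewrite mxE; congr (_ * _); apply: eq_bigr => j _.
    by rewrite vsprojK ?mem_sl ?trD // mxE eqxx.
  rewrite /cartan vsprojK ?mem_sl ?trD //.
  by apply/is_diag_mxP => i j ij; rewrite mxE -val_eqE (negPf ij).
rewrite linearB /= vsproj_traceless vsprojK ?mem_sl ?trD //.
rewrite [LHS]mxE [(- D) i j]mxE [D i j]mxE.
have [->|ij] := eqVneq i j; first by rewrite subrr.
rewrite subr0; apply: (traceless_upper Aup); rewrite ltn_neqAle ji andbT.
by rewrite eq_sym.
Qed.

End GlAction.

(** * Transfer of linear relations to the tensor product *)

Section Transfer.
Variables (F : numClosedFieldType) (n : nat) (V : vectType F).
Variables (rho : {linear slT F n -> 'End(V)}) (v : V) (m : {ffun 'I_n -> nat}).
Hypothesis rhoV : irreducible_highest_weight rho (dominant_weight m) v.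
Variables (L : finType) (k : L -> 'I_n).
Hypothesis count_k : forall i, #|[set l | k l == i]| = m i.
Local Notation tensor := {ffun {ffun L * 'I_n.+1 -> 'I_n.+1} -> F^o}.
Implicit Types (A B : 'M[F]_n.+1) (bs : seq (posroot n)).

Definition tensor_act A (u : tensor) : tensor := tact k (traceless A) u.

Lemma tensor_act_action : is_gl_action tensor_act.
Proof.
split=> [A a u w|a A B u|A B u]; rewrite /tensor_act.
- exact: tactDr.
- by rewrite traceless_lin tactDl.
- by rewrite traceless_bracket tact_bracket.
Qed.

(** Weights add over the factors, and by [count_k] exactly m_i of them are of type i; so w has the
    same highest weight as v. *)
Lemma tensor_act_hw A : is_upper A -> tensor_act A (hwv F k) = hw_char m A *: hwv F k.
Proof.
move=> Aup; rewrite /tensor_act tact_hwv_upper; last exact: traceless_upper.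
congr (_ *: _); rewrite /hw_char (partition_big k xpredT) //=.
apply: eq_bigr => i _; rewrite (eq_bigr (fun _ => \sum_(j < n.+1 | (j <= i)%N) traceless A j j)).
  by rewrite sumr_const -[LHS]mulr_natl -count_k cardsE.
by move=> l /eqP ->.
Qed.

Definition pair_act A (x : V * tensor) : V * tensor := (gl_act rho A x.1, tensor_act A x.2).

Lemma pair_act_action : is_gl_action pair_act.
Proof.
have [H1 H2 H3] := gl_act_action rhoV; have [K1 K2 K3] := tensor_act_action.
by split=> [A a [u u'] [w w']|a A B [u u']|A B [u u']];
  rewrite /pair_act /= ?H1 ?H2 ?H3 ?K1 ?K2 ?K3.
Qed.

Let x0 : V * tensor := (v, hwv F k).

Lemma pair_act_hw A : is_upper A -> pair_act A x0 = hw_char m A *: x0.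
Proof. by move=> Aup; rewrite /pair_act (gl_act_hw rhoV) // tensor_act_hw. Qed.

Lemma hwv_neq0 : hwv F k != 0.
Proof.
apply/eqP => /ffunP /(_ (id_state n L)); rewrite hwv_id_state ffunE => /eqP.
by rewrite oner_eq0.
Qed.

Lemma root_word_pair bs (x : V * tensor) :
  root_word pair_act bs x = (root_word (gl_act rho) bs x.1, root_word tensor_act bs x.2).
Proof. by elim: bs => [|b bs] /=; [case: x|move=> ->]. Qed.

Local Notation killer := (height_killer pair_act (hw_char m)).

Lemma killer_pair D (x : V * tensor) : killer D x =
  (height_killer (gl_act rho) (hw_char m) D x.1, height_killer tensor_act (hw_char m) D x.2).
Proof. by elim: D => [|D] /=; [case: x|move=> ->]. Qed.

Definition cyclic_pair (x : V * tensor) : Prop := exists d, pbw pair_act x0 d x.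

Lemma cyclic_pair_lin a x y : cyclic_pair x -> cyclic_pair y -> cyclic_pair (a *: x + y).
Proof.
move=> [d xd] [e ye]; exists (maxn d e).
by apply: lin_span_lin; [apply: pbw_mono xd|apply: pbw_mono ye]; rewrite ?leq_maxl ?leq_maxr.
Qed.

Lemma cyclic_pair_act A x : cyclic_pair x -> cyclic_pair (pair_act A x).
Proof. by move=> [d xd]; exists d.+1; exact: pbw_act pair_act_action _ _ pair_act_hw _ _ _ xd. Qed.

Lemma height_killer0 (U : lmodType F) (act : 'M[F]_n.+1 -> U -> U) D :
  is_gl_action act -> height_killer act (hw_char m) D 0 = 0.
Proof. by move=> actP; elim: D => //= D ->; rewrite (act0r actP) scaler0 subr0. Qed.

Lemma dot0l (u : tensor) : dot 0 u = 0.
Proof. by rewrite /dot big1 // => g _; rewrite ffunE mul0r. Qed.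

Lemma adjmx_traceless A : adjmx (traceless A) = traceless (adjmx A).
Proof.
apply/matrixP => i j; rewrite !mxE rmorphB /= eq_sym.
congr (_ - _); case: (i == j); rewrite ?mulr0n ?rmorph0 // !mulr1n rmorphM fmorphV rmorph_nat.
by congr (_ / _); rewrite rmorph_sum; apply: eq_bigr => a _; rewrite mxE.
Qed.

Lemma dot_tensor_act A (u w : tensor) : dot (tensor_act A u) w = dot u (tensor_act (adjmx A) w).
Proof. by rewrite /tensor_act dot_tact adjmx_traceless. Qed.

Lemma adj_height_mx : adjmx (height_mx F n) = height_mx F n.
Proof.
apply/matrixP => i j; rewrite !mxE rmorphM /= !rmorph_nat eq_sym.
by case: eqP => [->|_] //; rewrite !mul0r.
Qed.

Lemma dot_hwv_neq0 : dot (hwv F k) (hwv F k) != 0.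
Proof. by apply: contra_neq hwv_neq0; exact: dot_eq0. Qed.

Lemma dotZl a (u w : tensor) : dot (a *: u) w = a * dot u w.
Proof. by rewrite -[a *: u]addr0 dotDl dot0l addr0. Qed.

Lemma dotC (u w : tensor) : dot u w = (dot w u)^*.
Proof. by rewrite /dot rmorph_sum; apply: eq_bigr => g _; rewrite rmorphM /= conjCK mulrC. Qed.

Lemma dotZr a (u w : tensor) : dot u (a *: w) = a^* * dot u w.
Proof. by rewrite dotC dotZl rmorphM /= -dotC. Qed.

(** An eigenvalue of a self-adjoint operator on a vector of nonzero norm is real. *)
Lemma hw_char_height_real : (hw_char m (height_mx F n))^* = hw_char m (height_mx F n).
Proof.
have := dot_tensor_act (height_mx F n) (hwv F k) (hwv F k).
rewrite adj_height_mx tensor_act_hw; last exact: height_mx_upper.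
by rewrite dotZl dotZr => /(mulIf dot_hwv_neq0).
Qed.

(** The height matrix is self-adjoint, so the killer can be moved onto the highest weight vector,
    which it multiplies by a known scalar. *)
Lemma dot_height_killer D (u : tensor) :
  dot (height_killer tensor_act (hw_char m) D u) (hwv F k) = killer_scalar F 0 D * dot u (hwv F k).
Proof.
elim: D => [|D IH] /=; first by rewrite /killer_scalar big_ord0 mul1r.
rewrite -scaleNr addrC dotDl IH dot_tensor_act adj_height_mx.
rewrite tensor_act_hw ?dotZr ?hw_char_height_real ?IH; last exact: height_mx_upper.
rewrite /killer_scalar big_ord_recr /=; ring.
Qed.

(* An element of the cyclic module is a multiple of (v, w) plus terms of lower
   weight, which the height killer removes. *)
Lemma cyclic_pair_top (x : V * tensor) : cyclic_pair x ->
  exists (c : F) (D : nat), [/\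
    height_killer (gl_act rho) (hw_char m) D x.1 = (c * killer_scalar F 0 D) *: v &
    height_killer tensor_act (hw_char m) D x.2 = (c * killer_scalar F 0 D) *: hwv F k].
Proof.
move=> [d xd]; have [c [D0 /(_ D0 (leqnn _))]] :=
  height_killer_pbw pair_act_action pair_act_hw xd.
by rewrite killer_pair => E; exists c, D0; split; [exact: (congr1 fst E)|exact: (congr1 snd E)].
Qed.

(* (0, b) pairs to zero with the highest weight vector, and so do all its
   translates; hence b is orthogonal to the cyclic module, which contains b. *)
Lemma cyclic_pair_snd_eq0 (b : tensor) : cyclic_pair (0, b) -> b = 0.
Proof.
have [_ _ [v_neq0 _ _]] := rhoV.
have top c : cyclic_pair (0, c) -> dot c (hwv F k) = 0.
  move=> /cyclic_pair_top[e [D []]] /=; rewrite height_killer0; last exact: gl_act_action rhoV.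
  move=> /esym/eqP; rewrite scaler_eq0 (negPf v_neq0) orbF => /eqP -> E.
  have := dot_height_killer D c; rewrite E dotZl mul0r => /esym/eqP.
  by rewrite mulf_eq0 (negPf (killer_scalar0_neq0 _ _)) => /eqP.
(* The adjoint of a root vector is its transpose; moved across, it turns c into another tensor
   paired with 0 in the cyclic module. *)
have words bs c : cyclic_pair (0, c) -> dot c (root_word tensor_act bs (hwv F k)) = 0.
  elim: bs c => [|b' bs IH] c cc /=; first exact: top.
  rewrite -[root_mx F b'](trmxK) -[X in _ = X](IH (tensor_act (root_mx F b')^T c)).
    rewrite dot_tensor_act; congr (dot _ (tensor_act _ _)).
    by apply/matrixP => i j; rewrite !mxE rmorph_nat.
  have := cyclic_pair_act (root_mx F b')^T cc; rewrite /pair_act /=.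
  by rewrite (act0r (gl_act_action rhoV)).
move=> cb; apply: dot_eq0; have [d bd] := cb.
suff H (x : V * tensor) : pbw pair_act x0 d x -> dot b x.2 = 0 by exact: H bd.
elim=> [|a y z [bs _ ->] _ IH]; first by rewrite dotC dot0l rmorph0.
by rewrite /= dotDr IH root_word_pair words // mulr0 addr0.
Qed.

Lemma invariant_subspace (P : V -> Prop) : P 0 -> (forall a x y, P x -> P y -> P (a *: x + y)) ->
  (forall A x, P x -> P (gl_act rho A x)) -> (forall x, P x -> x = 0) \/ (forall x, P x).
Proof.
move=> P0 Plin Pact; have [_ [_ irr] _] := rhoV; have PU := vspan_id P0 Plin.
have [x|U0|U1] := irr (vspan P).
- apply/subvP => _ /memv_imgP[u /PU Pu ->]; apply/PU.
  by rewrite -gl_act_sl; exact: Pact.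
- by left=> x /PU; rewrite U0 memv0 => /eqP.
- by right=> x; apply/PU; rewrite U1 memvf.
Qed.

(** These a form a submodule of V. If it were everything, (v, 0) would be cyclic, and its top
    coefficient c would be zero by the tensor component and nonzero by the component in V. *)
Lemma cyclic_pair_fst_eq0 (a : V) : cyclic_pair (a, 0) -> a = 0.
Proof.
have [_ _ [v_neq0 _ _]] := rhoV.
have cyc0 : cyclic_pair 0 by exists 0%N; exact: lin_span0.
have [|c x y|A x|H|H] := @invariant_subspace (fun a => cyclic_pair (a, 0)).
- exact: cyc0.
- move=> cx cy; have := cyclic_pair_lin c cx cy.
  by congr cyclic_pair; rewrite -[RHS]/(_, _); congr (_, _); rewrite /= scaler0 addr0.
- move=> cx; have := cyclic_pair_act A cx; rewrite /pair_act /=.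
  by rewrite (act0r tensor_act_action).
- exact: H.
have /cyclic_pair_top[c [D [/= E1 E2]]] := H v.
move: E2; rewrite height_killer0; last exact: tensor_act_action.
move=> /esym/eqP; rewrite scaler_eq0 (negPf hwv_neq0) orbF => /eqP c0.
move/eqP: E1; rewrite c0 scale0r.
rewrite (height_killer_hw (gl_act_action rhoV) (gl_act_hw rhoV)) scaler_eq0.
by rewrite (negPf v_neq0) (negPf (killer_scalar0_neq0 _ _)).
Qed.

Lemma transfer_words (I : Type) (r : seq I) (c : I -> F) (w : I -> seq (posroot n)) :
  \sum_(i <- r) c i *: root_word (gl_act rho) (w i) v = 0 <->
  \sum_(i <- r) c i *: root_word tensor_act (w i) (hwv F k) = 0.
Proof.
set a := \sum_(i <- r) _; set b := \sum_(i <- r) _.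
have cab : cyclic_pair (a, b).
  rewrite /a /b; elim: r {a b} => [|i r [d IH]].
    by rewrite !big_nil; exists 0%N; exact: lin_span0.
  rewrite !big_cons; apply: (@cyclic_pair_lin (c i) (_, _) (_, _)); last by exists d.
  by exists (size (w i)); apply: lin_span_mem; exists (w i) => //; rewrite root_word_pair.
by split=> E; move: cab; rewrite E; [exact: cyclic_pair_snd_eq0|exact: cyclic_pair_fst_eq0].
Qed.

End Transfer.

(** * Straightening *)

Lemma digits_lt (B n : nat) (d : 'I_n -> nat) : (forall i, (d i < B)%N) ->
  (\sum_(i < n) d i * B ^ i < B ^ n)%N.
Proof.
elim: n d => [|n IH] d dB; first by rewrite big_ord0 expn0.
rewrite big_ord_recr /= expnS.
apply: (@leq_trans ((d ord_max).+1 * B ^ n)%N); last by rewrite leq_mul2r dB orbT.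
rewrite mulSn ltn_add2r.
exact: (IH (fun i => d (widen_ord (leqnSn n) i)) (fun i => dB _)).
Qed.

(** Allows all row and column sums of a word to be packed into one exponent of a single parameter
    t. *)
Lemma digits_inj (B n : nat) (d d' : 'I_n -> nat) :
    (forall i, (d i < B)%N) -> (forall i, (d' i < B)%N) ->
  (\sum_(i < n) d i * B ^ i = \sum_(i < n) d' i * B ^ i)%N -> d =1 d'.
Proof.
elim: n d d' => [|n IH] d d' dB dB' E i; first by case: i.
have lt := digits_lt (fun i => dB (widen_ord (leqnSn n) i)).
have lt' := digits_lt (fun i => dB' (widen_ord (leqnSn n) i)).
move: E; rewrite !big_ord_recr /= => E.
have Bn : (0 < B ^ n)%N by exact: leq_ltn_trans lt.
have Emax : d ord_max = d' ord_max.
  have := congr1 (fun x => x %/ B ^ n)%N E.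
  by rewrite ![(_ + d _ * _)%N]addnC ![(_ + d' _ * _)%N]addnC !divnMDl // !divn_small // !addn0.
have [j ->|->//] := unliftP ord_max i.
move/eqP: E; rewrite Emax eqn_add2r => /eqP E.
have -> : lift ord_max j = widen_ord (leqnSn n) j by apply: val_inj; rewrite /= /bump leqNgt ltn_ord.
exact: (IH (fun i => d (widen_ord _ i)) (fun i => d' (widen_ord _ i))).
Qed.

(* Comparing the values at t and 2 t eliminates the terms of the family one by one. *)
Lemma lin_span_exponents (F : numFieldType) (U : lmodType F) (P : U -> Prop) (es : seq nat)
    (s : nat -> U) : uniq es ->
    (forall t : F, lin_span P (\sum_(e <- es) t ^+ e *: s e)) ->
  forall e, e \in es -> lin_span P (s e).
Proof.
elim: es s => // e0 es IH s /= /andP[e0es ues] H.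
pose s' e := (2 ^+ e - 2 ^+ e0) *: s e.
have Hes e : e \in es -> lin_span P (s e).
  move=> ees; have ne : (2 : F) ^+ e - 2 ^+ e0 != 0.
    rewrite subr_eq0 -!natrX eqr_nat eqn_exp2l //.
    by apply: contraNneq e0es => <-.
  suff : lin_span P (s' e).
    by move=> /(lin_span_scale ((2 ^+ e - 2 ^+ e0)^-1)); rewrite scalerA mulVf // scale1r.
  apply: IH => // t.
  have -> : \sum_(e <- es) t ^+ e *: s' e =
     \sum_(e <- e0 :: es) (2 * t) ^+ e *: s e - 2 ^+ e0 *: \sum_(e <- e0 :: es) t ^+ e *: s e.
    rewrite scaler_sumr -sumrB big_cons scalerA exprMn subrr add0r; apply: eq_bigr => i _.
    by rewrite scalerA exprMn -scalerBl -mulrBl mulrC -scalerA.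
  by apply: lin_span_sub => //; apply: lin_span_scale.
move=> e; rewrite inE => /orP[/eqP ->|/Hes //].
have := H 1; rewrite big_cons expr1n scale1r => H1.
rewrite -[s e0](addrK (\sum_(j <- es) 1 ^+ j *: s j)); apply: lin_span_sub => //.
by rewrite big_seq; apply: lin_span_sum => j jes; apply: lin_span_scale; exact: Hes.
Qed.

(** * Words and their row and column sums *)

Section Words.
Variable n : nat.
Implicit Types (b c : posroot n) (w bs : seq (posroot n)).

Fixpoint words (N : nat) : seq (seq (posroot n)) :=
  if N is N'.+1 then [seq b :: w | b <- index_enum (posroot n), w <- words N'] else [:: [::]].

Lemma mem_words N w : (w \in words N) = (size w == N).
Proof.
elim: N w => [|N IH] [|b w] /=; rewrite ?inE //.
  by apply/allpairsP => -[[c w'] [_ _ //]].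
apply/allpairsP/eqP => [[[c w'] [/= _]]|[]/eqP].
  by rewrite IH => /eqP <- [_ ->].
by rewrite -IH => wN; exists (b, w); rewrite mem_index_enum.
Qed.

Definition in_row w (p : 'I_n) := count (fun b => root_fst b == p) w.
Definition in_col w (p : 'I_n) := count (fun b => root_snd b == p) w.

Lemma in_rowE w p : in_row w p = (\sum_(c | root_fst c == p) count_mem c w)%N.
Proof.
elim: w => [|b w IH]; first by rewrite big1.
rewrite /in_row /=.
rewrite big_split /= -IH; congr (_ + _)%N; rewrite big_mkcond (bigD1 b) //=.
rewrite eqxx big1 ?addn0; first by case: eqP.
by move=> c /negPf cb; rewrite [b == c]eq_sym cb if_same.
Qed.

Lemma in_colE w p : in_col w p = (\sum_(c | root_snd c == p) count_mem c w)%N.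
Proof.
elim: w => [|b w IH]; first by rewrite big1.
rewrite /in_col /=.
rewrite big_split /= -IH; congr (_ + _)%N; rewrite big_mkcond (bigD1 b) //=.
rewrite eqxx big1 ?addn0; first by case: eqP.
by move=> c /negPf cb; rewrite [b == c]eq_sym cb if_same.
Qed.

Lemma sum_in_row w : (\sum_p in_row w p = size w)%N.
Proof.
elim: w => [|b w IH]; first by rewrite big1.
rewrite /in_row /= big_split /= -[in RHS]IH -[RHS]add1n; congr (_ + _)%N.
by rewrite (bigD1 (root_fst b)) //= eqxx big1 // => p /negPf; rewrite eq_sym => ->.
Qed.

(* The digits of the exponent of a word in base B are its column sums and its row
   sums, except for row a: that one is determined by the length of the word. *)
Definition margin_exp (B : nat) (a : 'I_n) b : nat :=
  ((if root_fst b == a then 0 else B ^ (root_fst b + n)) + B ^ root_snd b)%N.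

Lemma sum_margin_exp B a w : (\sum_(b <- w) margin_exp B a b =
  (\sum_(p < n) (if p == a then 0 else in_row w p) * B ^ p) * B ^ n +
  \sum_(p < n) in_col w p * B ^ p)%N.
Proof.
elim: w => [|b w IH].
  by rewrite big_nil !big1 // => p _; rewrite /in_row /= ?if_same mul0n.
rewrite big_cons IH /margin_exp.
have -> : (\sum_(p < n) in_col (b :: w) p * B ^ p = B ^ root_snd b + \sum_(p < n) in_col w p * B ^ p)%N.
  rewrite /in_col /=; under eq_bigr do rewrite mulnDl; rewrite big_split /=; congr (_ + _)%N.
  rewrite (bigD1 (root_snd b)) //= eqxx mul1n big1 ?addn0 //.
  by move=> p /negPf; rewrite eq_sym => ->.
have -> : (\sum_(p < n) (if p == a then 0 else in_row (b :: w) p) * B ^ p =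
   (if root_fst b == a then 0 else B ^ root_fst b) +
   \sum_(p < n) (if p == a then 0 else in_row w p) * B ^ p)%N.
  rewrite (bigD1 (root_fst b)) //= [in RHS](bigD1 (root_fst b)) //= {1}/in_row /= eqxx.
  rewrite addnA; congr (_ + _)%N; last first.
    by apply: eq_bigr => p /negPf pb; rewrite /in_row /= [root_fst b == p]eq_sym pb.
  by case: eqP => // _; rewrite mulnDl mul1n.
rewrite mulnDl expnD; case: eqP => _; lia.
Qed.

Lemma margin_exp_inj (a : 'I_n) w w' : size w = size w' ->
    (\sum_(b <- w) margin_exp (size w).+1 a b = \sum_(b <- w') margin_exp (size w).+1 a b)%N ->
  in_row w =1 in_row w' /\ in_col w =1 in_col w'.
Proof.
move=> ww; rewrite !sum_margin_exp => E.
have rowB u p : size u = size w -> ((if p == a then 0 else in_row u p) < (size w).+1)%N.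
  by move=> <-; case: ifP => // _; rewrite ltnS count_size.
have colB u p : size u = size w -> (in_col u p < (size w).+1)%N.
  by move=> <-; rewrite ltnS count_size.
have colw := digits_lt (fun p => colB w p erefl).
have colw' := digits_lt (fun p => colB w' p (esym ww)).
have Bn : (0 < (size w).+1 ^ n)%N by rewrite expn_gt0.
have Er : (\sum_(p < n) (if p == a then 0 else in_row w p) * (size w).+1 ^ p =
           \sum_(p < n) (if p == a then 0 else in_row w' p) * (size w).+1 ^ p)%N.
  by have := congr1 (fun x => x %/ (size w).+1 ^ n)%N E; rewrite !divnMDl // !divn_small ?addn0.
have {E} Ec : (\sum_(p < n) in_col w p * (size w).+1 ^ p =
           \sum_(p < n) in_col w' p * (size w).+1 ^ p)%N.
  by move: E; rewrite Er => /addnI.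
have row' := digits_inj (fun p => rowB w p erefl) (fun p => rowB w' p (esym ww)) Er.
split; last exact: (digits_inj (fun p => colB w p erefl) (fun p => colB w' p (esym ww)) Ec).
move=> p; have [->|pa] := eqVneq p a; last by have := row' p; rewrite (negPf pa).
have := sum_in_row w; rewrite ww -(sum_in_row w') (bigD1 a) //= [X in _ = X](bigD1 a) //=.
rewrite (eq_bigr (in_row w')) => [|q /negPf qa]; last by have := row' q; rewrite qa.
by move/addIn.
Qed.

End Words.

(** * Powers of a matrix modulo lower filtration steps *)

Section PowersOfMatrices.
Variables (F : numClosedFieldType) (n : nat) (U : lmodType F).
Variable act : 'M[F]_n.+1 -> U -> U.
Hypothesis actP : is_gl_action act.
Variables (u0 : U) (chi : 'M[F]_n.+1 -> F).
Hypothesis u0_hw : forall A, is_upper A -> act A u0 = chi A *: u0.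
Implicit Types (A : 'M[F]_n.+1).

Lemma pbw_iter A N : pbw act u0 N (iter N (act A) u0).
Proof.
elim: N => [|N IH]; first exact: (@pbw_word _ _ _ _ _ [::]).
exact: (pbw_act actP u0_hw).
Qed.

(** The upper part of A preserves each filtration step, so using it at one of the N + 1 places loses
    a degree. *)
Lemma pbw_iter_lower A N :
  pbw act u0 N (iter N.+1 (act A) u0 - iter N.+1 (act (lower_part A)) u0).
Proof.
elim: N => [|N IH].
  rewrite /= {1}[A]upper_lower_part (actDl actP) addrK.
  apply: (pbw_upper actP u0_hw); [exact: upper_part_upper|exact: (@pbw_word _ _ _ _ _ [::])].
rewrite iterS [X in _ - X]iterS {1}[A]upper_lower_part (actDl actP) -addrA -(actBr actP).
apply: lin_span_add; last by apply: (pbw_lower actP) => //; exact: lower_part_lower.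
by apply: (pbw_upper actP u0_hw); [exact: upper_part_upper|exact: pbw_iter].
Qed.

Lemma iter_lower_words A N u : is_lower A -> iter N (act A) u =
  \sum_(w <- words n N) (\prod_(b <- w) A (root_tgt b) (root_src b)) *: root_word act w u.
Proof.
move=> Al; elim: N => [|N IH]; first by rewrite /= big_seq1 big_nil scale1r.
rewrite iterS IH big_allpairs_dep {1}(lower_decomposition Al) (act_suml actP).
apply: eq_bigr => b _; rewrite (actZl actP) (act_sumr actP) scaler_sumr.
by apply: eq_bigr => w _; rewrite (actZr actP) scalerA big_cons.
Qed.

End PowersOfMatrices.

Section Decomposition.
Variables (n : nat) (m : {ffun 'I_n -> nat}).

Lemma FFL_antichains (s : multiexp n) : FFL m s ->
  exists (L : finType) (k : L -> 'I_n) (M : L -> {set posroot n}),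
    [/\ forall i, #|[set l | k l == i]| = m i, forall l, fund_antichain (k l) (M l) &
      forall c, s c = antichain_exp M c].
Proof.
case/FFL_minkowski => r [anti cnt sE]; exists 'I_(size r).
exists (fun l => (tnth (in_tuple r) l).1), (fun l => (tnth (in_tuple r) l).2); split.
- move=> i; rewrite -cnt -sum1_count -sum1_card (big_tnth _ _ r) /=.
  by apply: eq_bigl => l; rewrite inE.
- by move=> l; apply: anti; exact: mem_tnth.
- by move=> c; rewrite sE big_tnth.
Qed.

Lemma FFL0 : FFL m [ffun=> 0%N].
Proof. by move=> i j b p _; rewrite big1 // => c _; rewrite ffunE. Qed.

End Decomposition.

(** * Relations in V and straightening *)

Section Spanning.
Variables (F : numClosedFieldType) (n : nat) (V : vectType F).
Variables (rho : {linear slT F n -> 'End(V)}) (v : V) (m : {ffun 'I_n -> nat}).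
Hypothesis rhoV : irreducible_highest_weight rho (dominant_weight m) v.
Local Notation act := (gl_act rho).
Let actP := gl_act_action rhoV.
Let v_hw := gl_act_hw rhoV.
Implicit Types (b c : posroot n) (w bs : seq (posroot n)) (C : {set posroot n}).

(** On the tensor side only the factors with i <= k l <= j can absorb x y: y vanishes on the
    relevant indices if k l < i, and x is supported there if k l > j. The pair made of the power
    applied to v and of 0 is then cyclic. *)
Lemma gl_act_rank1_nilpotent (x : 'cV[F]_n.+1) (y : 'rV[F]_n.+1) (i j : 'I_n) N :
    y *m x = 0 -> (forall a : 'I_n.+1, (a < i)%N -> y 0 a = 0) ->
    (forall a : 'I_n.+1, (j.+1 < a)%N -> x a 0 = 0) ->
  (\sum_(l < n | (i <= l <= j)%N) m l < N)%N -> iter N (act (x *m y)) v = 0.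
Proof.
move=> yx y0 x0 sN; have [L [k [_ [cnt _ _]]]] := FFL_antichains (FFL0 m).
have trxy : \tr (x *m y) = 0 by rewrite mxtrace_mulC yx raddf0.
have W0 : iter N (tensor_act k (x *m y)) (hwv F k) = 0.
  have -> : tensor_act k (x *m y) = tact k (x *m y) by rewrite /tensor_act traceless_id.
  apply: (@iter_tact_rank1 _ _ _ _ _ _ [set l | (i <= k l <= j)%N]) => // [l g|].
    rewrite inE negb_and -!ltnNge => /orP[kl|kl].
      by apply: rank1_minor_eq0l => a ak; apply: y0; exact: leq_ltn_trans kl.
    by apply: rank1_minor_eq0r => // a ka; apply: x0; exact: leq_ltn_trans ka.
  apply: leq_ltn_trans sN; rewrite -sum1_card.
  rewrite (partition_big k (fun l => (i <= l <= j)%N)) /=; last by move=> l; rewrite inE.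
  apply: leq_sum => l _; rewrite -cnt -sum1_card big_mkcond [X in (_ <= X)%N]big_mkcond.
  by apply: leq_sum => l' _; rewrite !inE; case: ifP => // /andP[_ ->].
apply: (cyclic_pair_fst_eq0 rhoV cnt).
have <- : iter N (pair_act rho k (x *m y)) (v, hwv F k) = (iter N (act (x *m y)) v, 0).
  by rewrite -W0; elim: (N) => [|N1 IH] //; rewrite !iterS IH.
by elim: N {sN W0} => [|N IH]; [exists 0%N; exact: (@pbw_word _ _ _ _ _ [::])|exact: (cyclic_pair_act rhoV cnt)].
Qed.

Definition word_in (i j : 'I_n) w := all (in_range i j) w.

(* Taking y with entry 1 in position i, the entry x_i is free to ensure y x = 0;
   it does not contribute to the strictly lower triangular part of x y. *)
Lemma words_margin_pbw (i j : 'I_n) N (B e : nat) : (i <= j)%N ->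
    (\sum_(l < n | (i <= l <= j)%N) m l < N.+1)%N ->
  pbw act v N (\sum_(w <- words n N.+1 | word_in i j w && (\sum_(b <- w) margin_exp B i b == e)%N)
    root_word act w v).
Proof.
move=> ij sN; pose E w := (\sum_(b <- w) margin_exp B i b)%N.
pose s e := \sum_(w <- words n N.+1 | word_in i j w && (E w == e)) root_word act w v.
pose es := undup [seq E w | w <- words n N.+1].
have [ees|nees] := boolP (e \in es); last first.
  rewrite big_seq_cond big_pred0 => [|w]; first exact: lin_span0.
  apply/negP => /and3P[wN _ /eqP Ew]; case/negP: nees.
  by rewrite mem_undup; apply/mapP; exists w.
apply: (lin_span_exponents (es := es) (s := s)) => //; first exact: undup_uniq.
move=> t; have -> : \sum_(e <- es) t ^+ e *: s e =
    \sum_(w <- words n N.+1 | word_in i j w) t ^+ E w *: root_word act w v.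
  transitivity (\sum_(e <- es) \sum_(w <- words n N.+1 | word_in i j w && (E w == e))
      t ^+ E w *: root_word act w v).
    by apply: eq_bigr => e' _; rewrite scaler_sumr; apply: eq_bigr => w /andP[_ /eqP ->].
  rewrite (exchange_big_dep (word_in i j)) /=; last by move=> e' w _ /andP[].
  rewrite big_seq_cond [RHS]big_seq_cond; apply: eq_bigr => w /andP[wN win].
  rewrite -big_filter (eq_filter (a2 := pred1 (E w))) => [|e']; last first.
    by rewrite /= win eq_sym.
  rewrite filter_pred1_uniq ?big_seq1 ?undup_uniq // mem_undup.
  by apply/mapP; exists w.
(* The entries are powers of t chosen so that the coefficient of the root vector of b in x y is t to
   the power [margin_exp B i b]: the source contributes through y, the target, one more than
   [root_snd b], through x. *)
pose Y (a : nat) : F := if (i <= a <= j)%N then (if a == i then 1 else t ^+ (B ^ (a + n))) else 0.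
pose X' (a : nat) : F := if (i < a <= j.+1)%N then t ^+ (B ^ a.-1) else 0.
pose iw := widen_ord (leqnSn n) i.
pose S := \sum_(a < n.+1 | a != iw) Y a * X' a.
pose x : 'cV[F]_n.+1 := \col_(a < n.+1) if a == iw then - S else X' a.
pose y : 'rV[F]_n.+1 := \row_(a < n.+1) Y a.
have yx : y *m x = 0.
  apply/matrixP => p q; rewrite !ord1 mxE (bigD1 iw) //= !mxE eqxx.
  rewrite /Y leqnn ij eqxx mul1r (eq_bigr (fun a : 'I_n.+1 => Y a * X' a)) ?addNr //.
  by move=> a /negPf aw; rewrite !mxE aw.
have zN : iter N.+1 (act (x *m y)) v = 0.
  apply: (gl_act_rank1_nilpotent yx _ _ sN) => a.
    by move=> ai; rewrite mxE /Y leqNgt ai.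
  move=> ja; rewrite mxE /X' [(a <= _)%N]leqNgt ja andbF.
  by case: eqP => // ai; move: ja; rewrite ai /=; lia.
have := pbw_iter_lower actP v_hw (x *m y) N; rewrite zN.
rewrite sub0r => /lin_span_opp; rewrite opprK (iter_lower_words actP); last exact: lower_part_lower.
congr (lin_span _ _); rewrite [RHS]big_mkcond; apply: eq_bigr => w _.
have coef b : lower_part (x *m y) (root_tgt b) (root_src b) =
    if in_range i j b then t ^+ margin_exp B i b else 0.
  rewrite mxE leqNgt (root_src_lt_tgt (eqxx _)) /= mxE big_ord1 !mxE.
  rewrite root_srcE /in_range /Y; have := root_fst_snd b.
  have -> : root_tgt b == iw = ((root_snd b).+1 == i) by rewrite -val_eqE.
  case: (leqP i (root_fst b)) => [ib|bi] bb; last by rewrite mulr0.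
  rewrite gtn_eqF ?ltnS; last by lia.
  rewrite /X' root_tgtE !ltnS /=.
  have -> : (i <= root_snd b)%N by exact: leq_trans ib bb.
  case: leqP => bj; last by rewrite mul0r.
  rewrite (leq_trans bb bj) /margin_exp.
  rewrite (_ : (root_fst b == i) = (root_fst b == i :> nat)); last by rewrite -val_eqE.
  by case: eqP => _; rewrite ?mulr1 // exprD mulrC.
rewrite (eq_bigr _ (fun b _ => coef b)) /word_in /E.
have -> : \prod_(b <- w) (if in_range i j b then t ^+ margin_exp B i b else 0) =
    if all (in_range i j) w then t ^+ (\sum_(b <- w) margin_exp B i b)%N else 0.
  elim: w => [|b w IH] /=; first by rewrite !big_nil.
  rewrite !big_cons IH exprD; case: in_range; rewrite ?mul0r //.
  by case: all; rewrite ?mulr0.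
by case: all; rewrite ?scale0r.
Qed.

(** Length first, then potential. Both are additive under concatenation, so the order is compatible
    with prefixing letters. *)
Definition lower_word bs bs' : bool := (size bs' < size bs)%N ||
  (size bs' == size bs) && (potential (fun c => count_mem c bs') < potential (fun c => count_mem c bs))%N.

Definition lower_span bs : V -> Prop :=
  lin_span (fun u => exists2 bs', lower_word bs bs' & u = root_word act bs' v).

Lemma pbw_lower_span bs d u : (d < size bs)%N -> pbw act v d u -> lower_span bs u.
Proof.
move=> dbs; apply: lin_span_sub_span => _ [bs' bd ->]; apply: lin_span_mem; exists bs' => //.
by rewrite /lower_word (leq_ltn_trans bd dbs).
Qed.

(* The words with the same row and column sums as bs add up to an element of the
   lower filtration step, and bs is the one of largest potential among them. *)
Lemma straighten_chain C (i j : 'I_n) bs :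
    (0 < size bs)%N -> is_chain C -> {in C, forall c, in_range i j c} -> {subset bs <= C} ->
    (\sum_(l < n | (i <= l <= j)%N) m l < size bs)%N ->
  lower_span bs (root_word act bs v).
Proof.
move=> bs0 chC rC bsC; case Ebs: (size bs) bs0 => [//|N] _ sN.
have ij : (i <= j)%N.
  case: bs bsC Ebs => // b bs bsC _; have /rC := bsC b (mem_head _ _).
  by rewrite /in_range; have := root_fst_snd b; lia.
pose E w := (\sum_(b <- w) margin_exp N.+2 i b)%N.
pose r := [seq w <- words n N.+1 | word_in i j w && (E w == E bs)].
have := words_margin_pbw N.+2 (E bs) ij sN; rewrite -big_filter -/r => rN.
have rP w : w \in r -> size w = size bs /\ ((forall c, count_mem c w = count_mem c bs) \/
    (potential (fun c => count_mem c w) < potential (fun c => count_mem c bs))%N).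
  rewrite mem_filter mem_words => /andP[/andP[_ /eqP Ew] /eqP sw]; rewrite sw Ebs; split=> //.
  have [row col] : in_row w =1 in_row bs /\ in_col w =1 in_col bs.
    by apply: (@margin_exp_inj _ i); rewrite ?sw ?Ebs.
  have [] := @potential_chain n (fun c => count_mem c bs) (fun c => count_mem c w); [| |..].
  - by move=> p; rewrite -!in_rowE.
  - by move=> p; rewrite -!in_colE.
  - by move=> c d; rewrite -!has_count !has_pred1 => /bsC cC /bsC dC; exact: chC.
  - by left.
  - by right.
pose q w := perm_eq w bs.
have rest : lower_span bs (\sum_(w <- r | ~~ q w) root_word act w v).
  rewrite big_seq_cond; apply: lin_span_sum => w /andP[/rP[sw [cw|lw]] nq].
    by case/negP: nq; apply/allP => c _; rewrite /= cw.
  by apply: lin_span_mem; exists w => //; rewrite /lower_word sw eqxx lw orbT.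
have same : lower_span bs (\sum_(w <- r | q w) root_word act w v - (count q r)%:R *: root_word act bs v).
  rewrite -sum1_count natr_sum scaler_suml -sumrB; apply: lin_span_sum => w qw.
  rewrite scale1r; apply: (@pbw_lower_span _ N); first by rewrite Ebs.
  by apply: (root_word_perm actP) => //; rewrite (perm_size qw) Ebs.
(* The permutations of bs among the words of r all agree with bs modulo shorter words, so bs appears
   with their number as coefficient; bs itself is one of them. *)
have cq : (count q r)%:R != 0 :> F.
  rewrite pnatr_eq0 -lt0n -has_count; apply/hasP; exists bs; last exact: perm_refl.
  rewrite mem_filter mem_words Ebs !eqxx !andbT; apply/allP => b /bsC; exact: rC.
suff : lower_span bs ((count q r)%:R *: root_word act bs v).
  by move=> /(lin_span_scale ((count q r)%:R^-1)); rewrite scalerA mulVf // scale1r.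
rewrite -[_ *: _](subKr (\sum_(w <- r | q w) root_word act w v)); apply: lin_span_sub => //.
have -> : \sum_(w <- r | q w) root_word act w v =
    \sum_(w <- r) root_word act w v - \sum_(w <- r | ~~ q w) root_word act w v.
  by rewrite [X in _ = X - _](bigID q) /= addrK.
by apply: lin_span_sub => //; apply: pbw_lower_span rN; rewrite Ebs.
Qed.

Definition exp_of_word bs : multiexp n := [ffun c => count_mem c bs].

(** The letters on a violated chain are moved next to v and straightened by [straighten_chain]; the
    other letters are prefixed again, which preserves the order. *)
Lemma straighten bs : ~ FFL m (exp_of_word bs) -> lower_span bs (root_word act bs v).
Proof.
move=> nF; have [i [j [C [chC rC lt]]]] : exists (i j : 'I_n) C, [/\ is_chain C,
    {in C, forall c, in_range i j c} &
    (\sum_(k < n | (i <= k <= j)%N) m k < \sum_(c in C) exp_of_word bs c)%N].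
  apply: contrapT => nex; apply: nF; apply/FFL_chainP => i j C chC rC.
  by rewrite leqNgt; apply/negP => lt; apply: nex; exists i, j, C.
pose p := [seq b <- bs | b \in C]; pose r := [seq b <- bs | b \notin C].
have pbs : perm_eq bs (r ++ p) by rewrite perm_sym perm_catC; apply/permPl/perm_filterC.
have sp : size p = (\sum_(c in C) exp_of_word bs c)%N.
  rewrite size_filter -sum1_count /exp_of_word.
  under [RHS]eq_bigr do rewrite ffunE -sum1_count.
  rewrite (exchange_big_dep xpredT) //= big_mkcond; apply: eq_bigr => b _.
  case: ifP => bC; first by rewrite (big_pred1 b) // => c; rewrite andbC eq_sym /=; case: eqP => [->|].
  by rewrite big_pred0 // => c; rewrite andbC; case: eqP => // <-.
have p0 : (0 < size p)%N by rewrite sp; exact: leq_ltn_trans lt.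
have sbs : size bs = (size r + size p)%N by rewrite (perm_size pbs) size_cat.
rewrite -[root_word act bs v](subrK (root_word act (r ++ p) v)); apply: lin_span_add.
  apply: (@pbw_lower_span _ (size bs).-1); first by rewrite prednK // sbs; lia.
  by apply: (root_word_perm actP) => //; rewrite prednK // sbs; lia.
rewrite root_word_cat.
have : lower_span p (root_word act p v).
  by apply: straighten_chain (chC) (rC) _ _ => //; [move=> b; rewrite mem_filter => /andP[]|rewrite sp].
apply: lin_span_linear => [a u u'|_ [p' pp' ->]]; first exact: (root_word_lin actP).
apply: lin_span_mem; exists (r ++ p'); last by rewrite root_word_cat.
have potE w : potential (fun c => count_mem c (r ++ w)) =
    (potential (fun c => count_mem c r) + potential (fun c => count_mem c w))%N.
  by apply: potentialD => c; rewrite count_cat.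
have -> : lower_word bs (r ++ p') = lower_word (r ++ p) (r ++ p').
  rewrite /lower_word (perm_size pbs); congr (_ || (_ && (_ < _)%N)).
  by rewrite /potential /tail_sum; do 3!apply: eq_bigr => ? _; exact: (seq.permP pbs).
by move: pp'; rewrite /lower_word !potE !size_cat ltn_add2l eqn_add2l ltn_add2l.
Qed.

End Spanning.

(** * The monomial basis *)

Section ExponentWords.
Variable n : nat.
Implicit Types (s t : multiexp n) (w : seq (posroot n)).

(** Sorted by source because [foldr_root_mx] gives the coordinates of such words. *)
Definition exp_word s : seq (posroot n) :=
  sort (fun b c => root_fst b <= root_fst c)%N
    (flatten [seq nseq (s c) c | c <- index_enum (posroot n)]).

Lemma exp_word_sorted s : sorted (fun b c => root_fst b <= root_fst c)%N (exp_word s).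
Proof. by apply: sort_sorted => b c; exact: leq_total. Qed.

Lemma count_exp_word s c : count_mem c (exp_word s) = s c.
Proof.
rewrite (seq.permP (permEl (perm_sort _ _))) count_flatten -map_comp sumnE big_map.
rewrite (bigD1 c) //= count_nseq /= eqxx mul1n big1 ?addn0 // => b /negPf bc.
by rewrite count_nseq /= bc.
Qed.

Lemma sum_count_mem (R : nmodType) (f : posroot n -> R) w :
  \sum_(b <- w) f b = \sum_b f b *+ count_mem b w.
Proof.
elim: w => [|c w IH]; first by rewrite big_nil big1.
rewrite big_cons IH /=; under [RHS]eq_bigr do rewrite mulrnDr.
rewrite big_split /=; congr (_ + _); rewrite (bigD1 c) //= eqxx mulr1n big1 ?addr0 // => b /negPf.
by rewrite eq_sym => ->.
Qed.

Lemma size_exp_word s : size (exp_word s) = deg s.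
Proof.
rewrite -sum1_size (sum_count_mem (fun=> 1%N)) /deg; apply: eq_bigr => b _.
by rewrite count_exp_word; elim: (s b) => // k IH; rewrite mulrS IH.
Qed.

Lemma exp_word_of_word w : perm_eq w (exp_word (exp_of_word w)).
Proof. by apply/allP => c _; rewrite /= count_exp_word ffunE. Qed.

End ExponentWords.

Section Basis.
Variables (F : numClosedFieldType) (n : nat) (V : vectType F).
Variables (rho : {linear slT F n -> 'End(V)}) (v : V) (m : {ffun 'I_n -> nat}).
Hypothesis rhoV : irreducible_highest_weight rho (dominant_weight m) v.
Local Notation act := (gl_act rho).
Let actP := gl_act_action rhoV.
Let v_hw := gl_act_hw rhoV.
Implicit Types (s t : multiexp n) (w : seq (posroot n)).

Definition ffl_vector s : V := root_word act (exp_word s) v.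

Definition ffl_span (d : nat) : V -> Prop :=
  lin_span (fun u => exists2 t, FFL m t /\ (deg t <= d)%N & u = ffl_vector t).

Lemma ffl_span_mono d d' u : (d <= d')%N -> ffl_span d u -> ffl_span d' u.
Proof.
move=> dd; apply: lin_span_sub_span => _ [t [tF td] ->]; apply: lin_span_mem; exists t => //.
by split=> //; exact: leq_trans dd.
Qed.

(** Induction on the length, then on the potential. A word with exponent in S(lambda) agrees with
    its sorted form modulo shorter words; any other word is straightened. *)
Lemma word_ffl_span w : ffl_span (size w) (root_word act w v).
Proof.
have [N] := ubnP (size w); elim: N w => // N IHN w; rewrite ltnS => wN.
have IHpbw d u : (d < N)%N -> pbw act v d u -> ffl_span d u.
  move=> dN; elim=> [|a _ u' [w' wd ->] _ IH]; first exact: lin_span0.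
  apply: lin_span_lin => //; apply: (ffl_span_mono wd); apply: IHN.
  exact: leq_ltn_trans wd dN.
have [M] := ubnP (potential (fun c => count_mem c w)); elim: M w wN => // M IHM w wN.
rewrite ltnS => wM; have [wF|/(straighten rhoV)] := pselect (FFL m (exp_of_word w)).
  have eqw := exp_word_of_word w.
  have sw : (deg (exp_of_word w) = size w)%N by rewrite -size_exp_word -(perm_size eqw).
  rewrite -[root_word act w v](subrK (ffl_vector (exp_of_word w))); apply: lin_span_add; last first.
    by apply: lin_span_mem; exists (exp_of_word w) => //; rewrite sw.
  case sz : (size w) => [|d].
    have /nilP -> : nilp w by rewrite /nilp sz.
    rewrite /ffl_vector; have -> : exp_word (exp_of_word [::]) = [::] :> seq (posroot n).
      by apply/size0nil; rewrite -(perm_size (exp_word_of_word [::])).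
    by rewrite subrr; exact: lin_span0.
  apply: (@ffl_span_mono d) => //; apply: IHpbw; first by rewrite -sz.
  by apply: (root_word_perm actP) => //; rewrite sz.
apply: (@lin_span_linear _ _ _ _ _ id) => // _ [w' ww' ->].
move: ww'; rewrite /lower_word => /orP[lt|/andP[/eqP E lt]].
  apply: (@ffl_span_mono (size w')); first exact: ltnW.
  by apply: IHN; exact: leq_trans lt wN.
rewrite -/(ffl_span _ _) -E; apply: IHM; first by rewrite E.
exact: leq_trans lt wM.
Qed.

Lemma pbw_ffl_span d u : pbw act v d u <-> ffl_span d u.
Proof.
split.
  apply: (@lin_span_linear _ _ _ _ _ id) => // _ [w wd ->]; apply: (ffl_span_mono wd); exact: word_ffl_span.
apply: lin_span_sub_span => _ [t [_ td] ->]; apply: lin_span_mem; exists (exp_word t) => //.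
by rewrite size_exp_word.
Qed.

Lemma ffl_independent (r : seq (multiexp n)) (c : multiexp n -> F) :
    uniq r -> (forall t, t \in r -> FFL m t) ->
    \sum_(t <- r) c t *: ffl_vector t = 0 ->
  forall t, t \in r -> c t = 0.
Proof.
move=> ur rF sum0 t1 t1r; apply/eqP/negPn/negP => ct1.
pose om (t : multiexp n) := root_lex_weight t.
(* With minimal weight, t0 is preceded by no other term of the relation, so its essential coordinate
   sees t0 alone. *)
have [t0 [t0r ct0 t0min]] : exists t0, [/\ t0 \in r, c t0 != 0 &
    forall t, t \in r -> c t != 0 -> (om t0 <= om t)%N].
  have [N] := ubnP (om t1); elim: N t1 t1r ct1 => // N IH t1 t1r ct1; rewrite ltnS => lt.
  have [[t [tr ct ltt]]|nex] := pselect (exists t, [/\ t \in r, c t != 0 & (om t < om t1)%N]).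
    by apply: (IH t) => //; exact: leq_trans ltt lt.
  exists t1; split=> // t tr ct; rewrite leqNgt; apply/negP => ltt; apply: nex.
  by exists t.
(* The tensor product is indexed by the antichain decomposition of t0; it has m_i factors of type i
   for every choice of t0, so the relation transfers to it. *)
have [L [k [M [cnt anti t0E]]]] := FFL_antichains (rF _ t0r).
have := (transfer_words rhoV cnt r c (@exp_word n)).1 sum0.
move=> /ffunP /(_ (antichain_state M)); rewrite sum_ffunE ffunE.
have wordE t : root_word (tensor_act k) (exp_word t) (hwv F k) =
    foldr (fun b => tact k (root_mx F b)) (hwv F k) (exp_word t).
  elim: (exp_word t) => //= b bs IH; rewrite /root_word /= in IH *.
  by rewrite IH /tensor_act traceless_root_mx.
rewrite (bigD1_seq t0) //= big_seq_cond big1 ?addr0 => [|t /andP[tr tt0]].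
  rewrite ffunE wordE => /eqP; rewrite mulf_eq0 (negPf ct0) /=.
  rewrite (negPf (word_antichain_state_neq0 _ anti _ _)) //; first exact: exp_word_sorted.
  by move=> b; rewrite count_exp_word t0E.
rewrite ffunE wordE; have [->|ct] := eqVneq (c t) 0; first by rewrite scale0r.
have [->|nz] := eqVneq (foldr (fun b => tact k (root_mx F b)) (hwv F k) (exp_word t) (antichain_state M)) 0.
  by rewrite scaler0.
have [E|] := word_antichain_state anti (exp_word_sorted t) nz.
  by case/eqP: tt0; apply/ffunP => b; rewrite t0E -E count_exp_word.
have omE (f : posroot n -> nat) t' : f =1 t' -> root_lex_weight f = om t'.
  by move=> E; apply: eq_bigr => b _; rewrite E.
rewrite (omE _ t) => [|b]; last by rewrite count_exp_word.
rewrite (omE _ t0) => [|b]; last by rewrite t0E.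
by rewrite ltnNge t0min.
Qed.

End Basis.

(** * Weights and graded characters *)

Section WeightForms.
Variables (F : numClosedFieldType) (n : nat).
Implicit Types (mu nu : weight n) (h : slT F n).

Lemma weight_formD mu nu h : weight_form (mu + nu) h = weight_form mu h + weight_form nu h.
Proof.
rewrite /weight_form -big_split; apply: eq_bigr => i _.
by rewrite mxE intrD mulrDl.
Qed.

Lemma weight_formN mu h : weight_form (- mu) h = - weight_form mu h.
Proof.
by rewrite /weight_form -sumrN; apply: eq_bigr => i _; rewrite mxE mulrNz mulNr.
Qed.

Lemma weight_form0 h : weight_form (0 : weight n) h = 0.
Proof. by rewrite /weight_form big1 // => i _; rewrite mxE mul0r. Qed.

Lemma weight_form_sum (I : Type) (r : seq I) (p : pred I) (f : I -> weight n) h :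
  weight_form (\sum_(i <- r | p i) f i) h = \sum_(i <- r | p i) weight_form (f i) h.
Proof. by apply: (big_morph (fun mu => weight_form mu h)) => [mu nu|]; [exact: weight_formD|exact: weight_form0]. Qed.

Lemma weight_form_root b h :
  weight_form (root_weight b) h =
  vsval h (root_src b) (root_src b) - vsval h (root_tgt b) (root_tgt b).
Proof.
rewrite weight_form_sum (eq_bigr _ (fun i _ => simple_root_form i h)).
(* The sum of simple roots telescopes; [inord] turns the diagonal entries into a function on natural
   numbers for that purpose. *)
pose d (j : nat) : F := - vsval h (inord j) (inord j).
have srcE (i : 'I_n) : - vsval h (widen_ord (leqnSn n) i) (widen_ord (leqnSn n) i) = d i.
  by rewrite /d (_ : inord i = widen_ord (leqnSn n) i) //; apply: val_inj; rewrite /= inordK // ltnW // ltnS.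
have tgtE (i : 'I_n) : - vsval h (lift ord0 i) (lift ord0 i) = d i.+1.
  by rewrite /d (_ : inord i.+1 = lift ord0 i) //; apply: val_inj; rewrite /= inordK ?ltnS.
rewrite /root_src /root_tgt -[vsval h (widen_ord _ _) _]opprK srcE tgtE addrC.
rewrite -(telescope_sumr d (leqW (root_fst_snd b))).
rewrite (big_nat_widen _ _ n) ?ltn_ord // big_geq_mkord big_mkcond [RHS]big_mkcond.
apply: eq_bigr => i _; rewrite andbC ltnS; case: ifP => // _.
by rewrite -[vsval h (widen_ord _ _) _]opprK srcE tgtE addrC.
Qed.

(** The simple coroots, dual to the fundamental weights: they read off the coordinates of a
    weight. *)
Definition coroot_mx (i : 'I_n) : 'M[F]_n.+1 :=
  \matrix_(a, b) if a == b then (a == i :> nat)%:R - (a == i.+1 :> nat)%:R else 0.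

Lemma sum_ord_eq (p : pred 'I_n.+1) (x : 'I_n.+1) :
  \sum_(a < n.+1 | p a) (a == x :> nat)%:R = (p x)%:R :> F.
Proof.
rewrite big_mkcond (bigD1 x) //= eqxx big1 ?addr0; first by case: (p x).
by move=> a; rewrite -val_eqE /= => /negPf ->; rewrite if_same.
Qed.

Lemma mxtrace_coroot i : \tr (coroot_mx i) = 0.
Proof.
rewrite /mxtrace (eq_bigr (fun a : 'I_n.+1 => (a == i :> nat)%:R - (a == i.+1 :> nat)%:R)).
  rewrite sumrB (sum_ord_eq xpredT (widen_ord (leqnSn n) i)).
  by rewrite (sum_ord_eq xpredT (lift ord0 i)) subrr.
by move=> a _; rewrite mxE eqxx.
Qed.

Definition coroot i : slT F n := vsproj (sl F n) (coroot_mx i).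

Lemma vsval_coroot i : vsval (coroot i) = coroot_mx i.
Proof. by rewrite vsprojK // mem_sl mxtrace_coroot. Qed.

Lemma cartan_coroot i : cartan (coroot i).
Proof.
by rewrite /cartan vsval_coroot; apply/is_diag_mxP => a b; rewrite mxE -val_eqE => /negPf ->.
Qed.

Lemma weight_form_coroot mu i : weight_form mu (coroot i) = (mu 0 i)%:~R.
Proof.
rewrite /weight_form (bigD1 i) //=.
have fund j : fund_weight j (coroot i) = (j == i)%:R :> F.
  rewrite /fund_weight vsval_coroot.
  rewrite (eq_bigr (fun a : 'I_n.+1 => (a == i :> nat)%:R - (a == i.+1 :> nat)%:R)); last first.
    by move=> a _; rewrite mxE eqxx.
  rewrite sumrB (sum_ord_eq (fun a => a <= j)%N (widen_ord (leqnSn n) i)).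
  rewrite (sum_ord_eq (fun a => a <= j)%N (lift ord0 i)) /= /bump add1n.
  by rewrite -val_eqE /=; case: (ltngtP i j) => /=; rewrite ?subrr ?subr0.
rewrite fund eqxx mulr1 big1 ?addr0 // => j ji.
by rewrite fund (negPf ji) mulr0.
Qed.

Lemma weight_form_inj mu nu :
  (forall h, cartan h -> weight_form mu h = weight_form nu h) -> mu = nu.
Proof.
move=> E; apply/rowP => i; apply: (@intr_inj F).
by have := E _ (cartan_coroot i); rewrite !weight_form_coroot.
Qed.

End WeightForms.

(** * Bases of the filtered weight spaces *)

Section WeightBasis.
Variables (F : numClosedFieldType) (n : nat) (V : vectType F).
Variables (rho : {linear slT F n -> 'End(V)}) (v : V) (m : {ffun 'I_n -> nat}).
Hypothesis rhoV : irreducible_highest_weight rho (dominant_weight m) v.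
Local Notation act := (gl_act rho).
Let actP := gl_act_action rhoV.
Let v_hw := gl_act_hw rhoV.
Local Notation lam := (dominant_weight m).
Local Notation vec := (ffl_vector rho v).
Implicit Types (s t : multiexp n) (w : seq (posroot n)) (mu : weight n).

Lemma word_weight w h : cartan h ->
  rho h (root_word act w v) =
  weight_form (lam - \sum_(b <- w) root_weight b) h *: root_word act w v.
Proof.
move=> hC; rewrite -gl_act_sl; elim: w => [|b w IH] /=.
  by rewrite big_nil subr0 gl_act_sl; have [_ _ [_ _ ->]] := rhoV.
rewrite (act_comm actP) IH (actZr actP).
have -> : vsval h *m root_mx F b - root_mx F b *m vsval h =
    - weight_form (root_weight b) h *: root_mx F b.
  rewrite weight_form_root; apply/matrixP => i j.
  have /is_diag_mxP hd := hC.
  have hd' a c : a != c -> vsval h a c = 0 by move=> ac; apply: hd.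
  rewrite !mxE (bigD1 i) //= big1 => [|c ci]; last by rewrite hd' ?mul0r // eq_sym.
  rewrite [X in _ - X](bigD1 j) //= [X in _ - (_ + X)]big1 => [|c cj]; last by rewrite hd' ?mulr0.
  rewrite !mxE; have [->|_] := eqVneq i (root_tgt b); have [->|_] := eqVneq j (root_src b);
    rewrite /=; ring.
rewrite (actZl actP) -scalerDl big_cons; congr (_ *: _).
rewrite !weight_formD !weight_formN !weight_formD; ring.
Qed.

Lemma sum_root_weight t : \sum_(b <- exp_word t) root_weight b = wt t.
Proof.
rewrite (sum_count_mem (@root_weight n)) /wt; apply: eq_bigr => b _.
by rewrite count_exp_word.
Qed.

Lemma ffl_vector_weight t h : cartan h -> rho h (vec t) = weight_form (lam - wt t) h *: vec t.
Proof. by move=> hC; rewrite /ffl_vector word_weight // sum_root_weight. Qed.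

Definition exp_bound : nat := (\sum_i m i)%N.

(** A finite list of S(lambda): by [FFL_le] every entry of an exponent is at most [exp_bound]. *)
Definition ffl_seq : seq (multiexp n) :=
  [seq t <- [seq [ffun c => nat_of_ord (f c)] : multiexp n |
      f : {ffun posroot n -> 'I_exp_bound.+1} <- enum {ffun posroot n -> 'I_exp_bound.+1}]
    | `[< FFL m t >]].

Lemma ffl_seq_uniq : uniq ffl_seq.
Proof.
rewrite filter_uniq // map_inj_uniq ?enum_uniq // => f g /ffunP E.
by apply/ffunP => c; apply: val_inj; have := E c; rewrite !ffunE.
Qed.

Lemma mem_ffl_seq t : (t \in ffl_seq) = `[< FFL m t >].
Proof.
rewrite mem_filter; case: asboolP => //= tF; apply/mapP.
have lt c : (t c < exp_bound.+1)%N.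
  rewrite ltnS; apply: (leq_trans (FFL_le c tF)).
  by rewrite big_mkcond leq_sum // => k _; case: ifP.
exists [ffun c => Ordinal (lt c)]; first by rewrite mem_enum.
by apply/ffunP => c; rewrite !ffunE.
Qed.

Lemma span_map_seq (r : seq (multiexp n)) u : uniq r ->
  u \in <<[seq vec t | t <- r]>>%VS <-> exists c, u = \sum_(t <- r) c t *: vec t.
Proof.
move=> ur; split; last first.
  move=> [c ->]; rewrite big_seq; apply: memv_suml => t tr.
  by apply/memvZ/memv_span/map_f.
elim: r ur u => [_ u|t r IH /= /andP[tr ur] u].
  by rewrite span_nil memv0 => /eqP ->; exists (fun=> 0); rewrite big_nil.
rewrite span_cons => /memv_addP[_ /vlineP[a ->] [u' /(IH ur)[c ->] ->]].
exists (fun s => if s == t then a else c s); rewrite big_cons eqxx; congr (_ + _).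
rewrite big_seq [RHS]big_seq; apply: eq_bigr => s sr.
by case: eqP tr => // <-; rewrite sr.
Qed.

Lemma ffl_vector_free (r : seq (multiexp n)) : uniq r -> {subset r <= ffl_seq} ->
  free [seq vec t | t <- r].
Proof.
elim: r => [|t r IH] /=; first by rewrite nil_free.
move=> /andP[tr ur] sr; rewrite free_cons IH // => [|s ss]; last by apply: sr; rewrite inE ss orbT.
rewrite andbT; apply/negP => /(span_map_seq _ ur).1 [c E].
have := @ffl_independent _ _ _ _ _ _ rhoV (t :: r) (fun s => if s == t then -1 else c s).
move=> /(_ _ _ _ t (mem_head _ _)); rewrite eqxx => H.
have /eqP : (-1 : F) = 0.
  apply: H; first by rewrite /= tr.
    by move=> s /sr; rewrite mem_ffl_seq => /asboolP.
  rewrite big_cons eqxx E scaleN1r addrC; apply/eqP; rewrite subr_eq0; apply/eqP.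
  rewrite big_seq [RHS]big_seq; apply: eq_bigr => s ss.
  by case: eqP tr => // <-; rewrite ss.
by rewrite oppr_eq0 oner_eq0.
Qed.

Lemma pbw_filtration_span d u :
  u \in pbw_filtration rho v d <-> ffl_span rho v m d u.
Proof.
rewrite -(pbw_ffl_span rhoV); split.
  have pbwV := vspan_id (@lin_span0 _ _ _ : pbw act v d 0) (@lin_span_lin _ _ _).
  move=> uV; apply/pbwV; move: uV; apply/subvP/vspan_min => _ [xs [xd xsN ->]].
  apply/pbwV; apply: (pbw_mono xd) => {xd}; elim: xs xsN => [|x xs IH] xsN /=.
    exact: (@pbw_word _ _ _ _ _ [::]).
  rewrite -gl_act_sl; apply: (pbw_lower actP).
    by move=> i j; exact: (xsN x (mem_head _ _)).
  by apply: IH => y yxs; apply: xsN; rewrite inE yxs orbT.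
elim=> [|a _ u' [w wd ->] _ IH]; first exact: mem0v.
apply: memvD => //; apply: memvZ; apply: mem_vspan.
exists [seq vsproj (sl F n) (root_mx F b) | b <- w]; split.
- by rewrite size_map.
- move=> _ /mapP[b _ ->] i j ij; rewrite -[root_mx F b]traceless_root_mx.
  by rewrite vsproj_traceless traceless_root_mx root_mx_lower.
- by elim: (w) => //= b w' ->; rewrite /gl_act traceless_root_mx.
Qed.

Definition weight_pred mu d : pred (multiexp n) := fun t => (mu == lam - wt t) && (deg t <= d)%N.

Lemma pbw_weight_basis mu d :
  pbw_weight rho v mu d = <<[seq vec t | t <- ffl_seq & weight_pred mu d t]>>%VS.
Proof.
apply/eqP; rewrite eqEsubv; apply/andP; split; last first.
  apply/span_subvP => x /mapP[t]; rewrite mem_filter mem_ffl_seq.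
  move=> /andP[/andP[/eqP -> td] /asboolP tF] ->.
  rewrite memv_cap; apply/andP; split.
    by apply/mem_weight_space => h hC; exact: ffl_vector_weight.
  by apply/pbw_filtration_span/lin_span_mem; exists t.
apply/subvP => u; rewrite memv_cap => /andP[/mem_weight_space uW /pbw_filtration_span uF].
pose r := [seq t <- ffl_seq | (deg t <= d)%N].
have ur : uniq r by rewrite filter_uniq // ffl_seq_uniq.
have [c uE] : exists c, u = \sum_(t <- r) c t *: vec t.
  elim: {uW} u / uF => [|a _ u' [t [tF td] ->] _ [c ->]].
    by exists (fun=> 0); rewrite big1 // => t _; rewrite scale0r.
  exists (fun s => (if s == t then a else 0) + c s).
  under [RHS]eq_bigr do rewrite scalerDl.
  rewrite big_split /=; congr (_ + _).
  rewrite (bigD1_seq t) //=; last by rewrite mem_filter td mem_ffl_seq; exact/asboolP.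
  by rewrite eqxx big1 ?addr0 // => s /negPf ->; rewrite scale0r.
(* Subtracting the scalar of weight mu from the action of h turns the expansion of u into a
   relation; independence then kills every coefficient of a different weight. *)
have cW t : t \in r -> c t != 0 -> mu = lam - wt t.
  move=> tr ct; apply/esym/(@weight_form_inj F) => h hC.
  apply/eqP; rewrite -subr_eq0.
  have /eqP : (weight_form (lam - wt t) h - weight_form mu h) * c t = 0; last first.
    by rewrite mulf_eq0 (negPf ct) orbF.
  pose c' s := (weight_form (lam - wt s) h - weight_form mu h) * c s.
  apply: (@ffl_independent _ _ _ _ _ _ rhoV r c') (tr).
  - exact: ur.
  - by move=> s; rewrite mem_filter mem_ffl_seq => /andP[_ /asboolP].
  have := uW h hC; rewrite uE linear_sum scaler_sumr => /eqP.
  rewrite -subr_eq0 -sumrB => /eqP E; rewrite -[RHS]E; apply: eq_bigr => s _.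
  by rewrite linearZ /= ffl_vector_weight // !scalerA -scalerBl /c' mulrBl [c s * _]mulrC.
rewrite uE big_seq; apply: memv_suml => t tr.
have [->|ct] := eqVneq (c t) 0; first by rewrite scale0r mem0v.
apply/memvZ/memv_span/map_f; move: (tr); rewrite !mem_filter => /andP[td tS].
by rewrite /weight_pred -(cW t) // eqxx td.
Qed.

Lemma dim_pbw_weight mu d :
  \dim (pbw_weight rho v mu d) = count (weight_pred mu d) ffl_seq.
Proof.
rewrite pbw_weight_basis (eqP (ffl_vector_free _ _)) ?size_map ?size_filter //.
  by rewrite filter_uniq // ffl_seq_uniq.
by move=> t; rewrite mem_filter => /andP[].
Qed.

(** The complement has the difference of the dimensions of consecutive steps, so it counts the
    exponents of degree exactly d. *)
Lemma gr_dim_count mu d :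
  gr_dim rho v mu d = count (fun t => (mu == lam - wt t) && (deg t == d)) ffl_seq.
Proof.
rewrite /gr_dim; case: d => [|d] /=.
  have := dimv_cap_compl (pbw_weight rho v mu 0) 0%VS; rewrite capv0 dimv0 add0n => ->.
  by rewrite dim_pbw_weight; apply: eq_count => t; rewrite /weight_pred leqn0.
have sub : (pbw_weight rho v mu d <= pbw_weight rho v mu d.+1)%VS.
  rewrite !pbw_weight_basis; apply: sub_span => x /mapP[t]; rewrite mem_filter.
  move=> /andP[/andP[tw td] tS] ->; apply: map_f.
  by rewrite mem_filter tS andbT /weight_pred tw leqW.
have := dimv_cap_compl (pbw_weight rho v mu d.+1) (pbw_weight rho v mu d).
rewrite (capv_idPr sub) !dim_pbw_weight => E; apply: (@addnI (count (weight_pred mu d) ffl_seq)).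
rewrite E -count_predUI [X in (_ + X)%N](eq_count (a2 := pred0)) => [|t /=].
  rewrite count_pred0 addn0; apply: eq_count => t /=; rewrite /weight_pred.
  by case: eqP => //= _; rewrite leq_eqVlt orbC.
rewrite /weight_pred; case: eqP => //= _; lia.
Qed.

End WeightBasis.

(** * From dimensions to graded characters *)

Section Characters.
Variables (F : numClosedFieldType) (n : nat) (V : vectType F).
Variables (rho : {linear slT F n -> 'End(V)}) (v : V) (m : {ffun 'I_n -> nat}).
Hypothesis rhoV : irreducible_highest_weight rho (dominant_weight m) v.
Local Notation lam := (dominant_weight m).
Implicit Types (s t : multiexp n) (mu : weight n).

Lemma fsum_FFL (R : nmodType) (f : multiexp n -> R) :
  \sum_(s \in FFL m) f s = \sum_(s <- ffl_seq m) f s.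
Proof.
rewrite (fsbigE (ffl_seq m)) ?ffl_seq_uniq // => [|s /= sS|s sF].
- rewrite big_seq_cond [RHS]big_seq; apply: eq_bigl => s.
  by apply/andP/idP => [[]//|sS]; split=> //; apply: mem_set; apply/asboolP; rewrite -mem_ffl_seq.
- by move: sS; rewrite mem_ffl_seq => /asboolP.
- by rewrite mem_ffl_seq => /negP[]; exact/asboolP.
Qed.

Lemma fsum_FFL_weight (R : nmodType) (f : multiexp n -> R) mu :
  \sum_(s \in FFL_weight m mu) f s = \sum_(s <- ffl_seq m | mu == lam - wt s) f s.
Proof.
rewrite -[RHS]big_filter (fsbigE [seq s <- ffl_seq m | mu == lam - wt s]).
- rewrite big_seq_cond [RHS]big_seq; apply: eq_bigl => s.
  apply/andP/idP => [[]//|sS]; split=> //; apply: mem_set.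
  by move: sS; rewrite mem_filter mem_ffl_seq => /andP[/eqP E /asboolP].
- by rewrite filter_uniq // ffl_seq_uniq.
- by move=> s /=; rewrite mem_filter mem_ffl_seq => /andP[/eqP E /asboolP sF].
- by move=> s [sF E]; rewrite mem_filter mem_ffl_seq E eqxx => /negP[]; exact/asboolP.
Qed.

Lemma gr_weight_char_FFL mu : gr_weight_char rho v mu =
  \sum_(s <- ffl_seq m | mu == lam - wt s) ('X^(deg s) : {poly int}).
Proof.
(* K exceeds every degree occurring in S(lambda), so the sum over all degrees reduces to 0, .., K -
   1. *)
pose K := (\sum_(s <- ffl_seq m) deg s)%N.+1.
have degK s : s \in ffl_seq m -> (deg s < K)%N.
  by move=> sS; rewrite ltnS (big_rem s sS) /= leq_addr.
rewrite /gr_weight_char (fsbigE (iota 0 K)) ?iota_uniq //; last first.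
  move=> d _; rewrite mem_iota /= add0n -leqNgt => Kd.
  rewrite (gr_dim_count rhoV) (_ : count _ _ = 0%N) ?scale0r //.
  apply/eqP; rewrite -leqn0 leqNgt -has_count; apply/hasPn => s sS.
  by rewrite negb_and ltn_eqF ?orbT // (leq_trans (degK _ sS)).
transitivity (\sum_(d <- iota 0 K) \sum_(s <- ffl_seq m | (mu == lam - wt s) && (deg s == d))
    ('X^(deg s) : {poly int})).
  apply: eq_big => [d|d _]; first exact: mem_set.
  rewrite (gr_dim_count rhoV) -natz scaler_nat -sum1_count -sumrMnr.
  by apply: eq_bigr => s /andP[_ /eqP ->].
rewrite (exchange_big_dep (fun s => mu == lam - wt s)) /=; last by move=> d s _ /andP[].
rewrite big_seq_cond [RHS]big_seq_cond; apply: eq_bigr => s /andP[sS sw].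
rewrite -big_filter (eq_filter (a2 := pred1 (deg s))) => [|d]; last by rewrite /= sw eq_sym.
have dK : deg s \in iota 0 K by rewrite mem_iota add0n degK.
by rewrite filter_pred1_uniq ?big_seq1 //; exact: (iota_uniq 0 K).
Qed.

Lemma gr_char_FFL : gr_char rho v =
  \sum_(s <- ffl_seq m) << ('X^(deg s) : {poly int}) *g lam - wt s >>.
Proof.
pose mus := undup [seq lam - wt s | s <- ffl_seq m].
rewrite /gr_char (fsbigE mus) ?undup_uniq //; last first.
  move=> mu _; rewrite mem_undup => mumus; rewrite gr_weight_char_FFL.
  rewrite big_seq_cond big_pred0 ?monalgU0 // => s.
  by apply/negP => /andP[sS /eqP E]; case/negP: mumus; apply/mapP; exists s.
transitivity (\sum_(mu <- mus) \sum_(s <- ffl_seq m | mu == lam - wt s)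
    << ('X^(deg s) : {poly int}) *g lam - wt s >>).
  apply: eq_big => [mu|mu _]; first exact: mem_set.
  rewrite gr_weight_char_FFL (big_morph _ (monalgUD mu) (monalgU0 mu)).
  by apply: eq_bigr => s /eqP <-.
rewrite (exchange_big_dep xpredT) //= big_seq [RHS]big_seq; apply: eq_bigr => s sS.
rewrite -big_filter (eq_filter (a2 := pred1 (lam - wt s))) //.
have smus : lam - wt s \in mus by rewrite mem_undup; apply/mapP; exists s.
by rewrite filter_pred1_uniq ?undup_uniq ?big_seq1.
Qed.

End Characters.

Local Open Scope classical_set_scope.

Theorem mainTheorem4 (R : realType) (n : nat) (n_gt0 : (0 < n)%N)
    (m : {ffun 'I_n -> nat}) (V : vectType R[i])
    (rho : {linear slT R[i] n -> 'End(V)}) (v : V)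
    (rhoV : irreducible_highest_weight rho (dominant_weight m) v) :
  (forall mu : weight n,
     gr_weight_char rho v mu = \sum_(s \in FFL_weight m mu) ('X^(deg s) : {poly int})) /\
  gr_char rho v =
    \sum_(s \in FFL m) << ('X^(deg s) : {poly int}) *g dominant_weight m - wt s >>.
Proof.
split=> [mu|]; first by rewrite fsum_FFL_weight; exact: gr_weight_char_FFL rhoV mu.
by rewrite fsum_FFL; exact: gr_char_FFL rhoV.
Qed.
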